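(* Let $G$ be a finite group. 1. $\mathsf c(G)\le 2$ if and only if $|G|\le 2$. 2. The following statements are equivalent: (a) $\mathsf c(G)=3$. (b) $\Delta(G)=\{1\}$. (c) $\daleth(G)=3$. (d) $G$ is isomorphic to $C_3$, or $C_2\times C_2$, or $C_3\times C_3$.
   Context: $C_n$ denotes a cyclic group of order $n$. Groups are written multiplicatively with identity $1_G$. Sequences. A sequence over $G$ is a finite collection $S=g_1\cdot\ldots\cdot g_\ell$ of elements of $G$, repetition allowed and order disregarded, i.e. an element of the free abelian monoid $\mathcal F(G)$ with basis $G$; the operation $\cdot$ is concatenation of sequences. $S$ is product-one if its terms can be ordered so that their product in $G$ equals $1_G$ (the empty sequence is product-one). $\mathcal B(G)$ is the monoid of all product-one sequences over $G$ under concatenation. $\mathcal A(G)$ is its set of atoms: the non-empty product-one sequences that are not the concatenation of two non-empty product-one sequences. Factorizations. For $S\in\mathcal B(G)$, a factorization of $S$ is an element $z$ of the free abelian monoid with basis $\mathcal A(G)$ (a finite multiset of atoms) whose atoms concatenate to $S$; $|z|$ is its number of atoms counted with multiplicity; $\mathsf Z(S)$ is the set of all factorizations of $S$ and $\mathsf L(S)=\{|z| : z\in\mathsf Z(S)\}$. Set of distances. For $A\subseteq\mathbb Z$, $\Delta(A)$ is the set of all positive integers $d$ for which there is $\ell\in A$ with $A\cap[\ell,\ell+d]=\{\ell,\ell+d\}$. $\Delta(G)=\bigcup_{S\in\mathcal B(G)}\Delta(\mathsf L(S))$. $\daleth$. $\daleth(G)=\sup\{\min(\mathsf L(S)\setminus\{2\})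 : S\in\mathcal B(G),\ 2\in\mathsf L(S)\}$, with the convention $\min\emptyset=\sup\emptyset=0$. Catenary degree. For factorizations $z,z'$, write $z=\gcd(z,z')\,y$, $z'=\gcd(z,z')\,y'$ (gcd in the free abelian monoid on atoms) and set $\mathsf d(z,z')=\max\{|y|,|y'|\}$. For $S\in\mathcal B(G)$, $\mathsf c(S)$ is the smallest $N\in\mathbb N_0\cup\{\infty\}$ such that any two $z,z'\in\mathsf Z(S)$ can be joined by a finite sequence $z=z_0,z_1,\ldots,z_k=z'$ in $\mathsf Z(S)$ with $\mathsf d(z_{i-1},z_i)\le N$ for all $i\in[1,k]$. $\mathsf c(G)=\sup\{\mathsf c(S) : S\in\mathcal B(G)\}$. *)

(* Defs.v *)
From HB Require Import structures.
From mathcomp Require Import all_boot all_order all_algebra all_fingroup.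
From mathcomp Require Import finmap multiset.
From mathcomp Require Import boolp classical_sets set_interval constructive_ereal.

Set Implicit Arguments.
Unset Strict Implicit.
Unset Printing Implicit Defensive.

Import Order.TTheory GRing.Theory Num.Theory.

Local Open Scope mset_scope.
Local Open Scope classical_set_scope.
Local Open Scope ring_scope.

(* The minimum of A, or x0 if A has no minimum. *)
Definition set_min d (T : porderType d) (x0 : T) (A : set T) : T :=
  xget x0 (A `&` lbound A).

Section Sequences.

Variable gT : finGroupType.

(* The elements of the free abelian monoid on gT are multisets: `+` is
   concatenation and mset0 is the empty sequence. *)
Definition product_one : set {mset gT} :=
  [set S | exists2 s : seq gT, perm_eq s S & (\prod_(x <- s) x)%g = 1%g].

Definition atoms : set {mset gT} :=
  [set S | [/\ product_one S, S != mset0 &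
     ~ exists T U : {mset gT},
         [/\ product_one T, product_one U, T != mset0, U != mset0
           & S = (T `+` U)%mset]]].

Definition factorizations (S : {mset gT}) : set {mset {mset gT}} :=
  [set z | (forall A, A \in z -> atoms A)
           /\ \big[msetD/mset0]_(A <- z) A = S].

Definition lengths (S : {mset gT}) : set int :=
  [set (size z)%:Z | z in factorizations S].

(* The multiset intersection `&` is the gcd of the free abelian monoid. *)
Definition fact_dist (z z' : {mset {mset gT}}) : nat :=
  let g := (z `&` z')%mset in
  maxn (size (z `\` g)%mset) (size (z' `\` g)%mset).

Definition chain_connected (S : {mset gT}) (N : \bar int) : Prop :=
  forall z z', factorizations S z -> factorizations S z' ->
  exists s : seq {mset {mset gT}},
    [/\ forall w, w \in s -> factorizations S w,
        path (fun u v => ((fact_dist u v)%:Z%:E <= N)%E) z s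
      & last z s = z'].

(* N0 with infinity is the nonnegative part of \bar int; +oo is always
   admissible, so that the default value is never used. *)
Definition catenary_elt (S : {mset gT}) : \bar int :=
  set_min +oo%E [set N | (0 <= N)%E /\ chain_connected S N].

End Sequences.

Definition catenary_degree (gT : finGroupType) : \bar int :=
  supremum 0%E [set catenary_elt S | S in @product_one gT].

Definition distances (A : set int) : set int :=
  [set d | 0 < d /\
     exists2 l, A l & A `&` [set` `[l, l + d]] = [set l; l + d]].

Definition delta (gT : finGroupType) : set int :=
  \bigcup_(S in @product_one gT) distances (lengths S).

Definition daleth (gT : finGroupType) : \bar int :=
  supremum 0%E
    [set (set_min 0 (lengths S `\ 2))%:E
       | S in [set S : {mset gT} | product_one S /\ lengths S 2]].

(* Main.v *)
Require Import Defs.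
From HB Require Import structures.
From mathcomp Require Import all_boot all_order all_algebra all_fingroup.
From mathcomp Require Import all_solvable finmap multiset zify.
From mathcomp Require Import boolp classical_sets set_interval constructive_ereal.

(** The implications are proved in the cycle (a), (b), (c), (d), (a), and the
    first claim falls out of the same estimates.

    Arithmetic. Two factorizations of different lengths that differ in few
    atoms differ in at least two atoms on the shorter side, because an atom is
    not a product of other atoms ([fact_dist_gap]). A chain that joins
    factorizations on both sides of a gap of size d in the set of lengths makes
    the jump in one step, so d + 2 is at most the catenary degree
    ([distances_le]). Moreover a group with more than two elements has a
    sequence whose lengths include 2 and a larger number: g^n (g^-1)^n for an
    element g of order n at least 3, and a^2 b^2 (ab)^2 if all squares are
    trivial ([has_relation_card]). This gives (a) to (b), (b) to (c), and the
    fact that a catenary degree at most 2 forces at most two elements.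

    Group theory, (c) to (d). If daleth is 3, then a sequence with a
    factorization into two atoms and one of another length also has one into
    three ([reaches3]). This property passes to subgroups in the sense that a
    sequence over a subgroup has the same atoms there, so it is refuted by
    exhibiting a sequence with lengths 2 and 4 but not 3 over a few small
    groups. A sequence g^n (g^-1)^n has only the lengths 2 and n, so all orders
    are at most 3. Over S3, A4, the group of order 27 and exponent 3, C2^3 and
    C3^3 explicit sequences are checked by computation. A group without these
    subgroups, in which all orders are at most 3, is elementary abelian of rank
    at most 2 ([reaches3_small_abelem]).

    Upper bound, (d) to (a). Over an abelian group the N-chains are built by
    induction on the sequence: two factorizations that share an atom are joined
    by removing it. If z has more than N atoms, an atom W with at most N terms
    is covered by all but one of them, so z shares an atom with a factorization
    containing W, and thus is joined to all of these. Only products of two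
    atoms with more than N terms need an argument
    ([chain_connected_abel]). In an elementary abelian group of order at most 4
    such atoms do not exist, and over C3 x C3 they have the form a^2 b^2 (ab) or
    a b (ab)^2, so that their products form a finite list
    ([long_atoms_C3xC3]). *)

Set Implicit Arguments.
Unset Strict Implicit.
Unset Printing Implicit Defensive.

Import Order.TTheory GRing.Theory Num.Theory.

Local Open Scope group_scope.
Local Open Scope mset_scope.
Local Open Scope ring_scope.
Local Open Scope nat_scope.

(** * Multisets and product-one sequences *)

Section Multisets.

Variable K : choiceType.
Implicit Types (A B C : {mset K}) (s t : seq K).

HB.instance Definition _ := Monoid.isComLaw.Build {mset K} mset0 (@msetD K)
  (@msetDA K) (@msetDC K) (@mset0D K).

Lemma perm_msetD A B : perm_eq (A `+` B) (A ++ B).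
Proof. by apply/allP => x _ /=; rewrite count_cat !count_mem_mset msetE2. Qed.

Lemma size_msetD A B : size (A `+` B) = size A + size B.
Proof. by rewrite (perm_size (perm_msetD A B)) size_cat. Qed.

Lemma size_seq_mset s : size (seq_mset s) = size s.
Proof. exact/perm_size/perm_eq_seq_mset. Qed.

Lemma seq_mset_cat s t : seq_mset (s ++ t) = seq_mset s `+` seq_mset t.
Proof. by apply/msetP => x; rewrite msetE2 !mset_seqE count_cat. Qed.

Lemma seq_mset_nseq n (x : K) : seq_mset (nseq n x) = msetn n x.
Proof. by apply/msetP => y; rewrite mset_seqE msetnE count_nseq /= eq_sym; case: eqP; rewrite ?mul1n. Qed.

Lemma mset_size0 A : size A = 0 -> A = mset0.
Proof. by move=> /eqP; rewrite size_mset_eq0 => /eqP. Qed.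

Lemma mset_size_gt0 A : (0 < size A) = (A != mset0).
Proof. by rewrite lt0n size_mset_eq0. Qed.

Lemma size_mset_cons (x : K) A : size (x +` A) = (size A).+1.
Proof. by rewrite size_msetD enum_msetn size_nseq. Qed.

Lemma msubD A B : A `<=` B -> B = A `+` (B `\` A).
Proof. by move=> /msetBDKC. Qed.

Lemma msub_addl A B : A `<=` A `+` B.
Proof. by apply/msubsetP => x; rewrite msetE2 leq_addr. Qed.

Lemma msub_mem (x : K) A : x \in A -> A = x +` (A `\ x).
Proof. by move=> xA; rewrite msetB1K. Qed.

Lemma size_msub A B : A `<=` B -> size A <= size B.
Proof. by move=> /msubD ->; rewrite size_msetD leq_addr. Qed.

Lemma msetDI A : injective (msetD A).
Proof. exact: can_inj (msetDKB A). Qed.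

End Multisets.

Section Products.

Variable gT : finGroupType.
Implicit Types (A B S T U V : {mset gT}) (z : {mset {mset gT}}).

Definition msum z : {mset gT} := \big[msetD/mset0]_(A <- z) A.

Lemma msum0 : msum mset0 = mset0.
Proof. by rewrite /msum big_mset0. Qed.

Lemma msumD z z' : msum (z `+` z') = msum z `+` msum z'.
Proof. by rewrite /msum (perm_big _ (perm_msetD z z')) big_cat. Qed.

Lemma msum1 A : msum [mset A] = A.
Proof. by rewrite /msum big_msetn. Qed.

Lemma mset0_or_mem z : z = mset0 \/ exists A : {mset gT}, A \in z.
Proof. by have [z0|[A Az]] := mset_0Vmem z; [left|right; exists A]. Qed.

Lemma product_one_seq (s : seq gT) :
  (\prod_(x <- s) x)%g = 1%g -> product_one (seq_mset s).
Proof. by move=> s1; exists s; rewrite // perm_sym perm_eq_seq_mset. Qed.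

Lemma product_one0 : product_one (mset0 : {mset gT}).
Proof. by exists [::]; rewrite ?big_nil // enum_mset0. Qed.

Lemma product_oneD S T :
  product_one S -> product_one T -> product_one (S `+` T).
Proof.
move=> [s sS s1] [t tT t1]; exists (s ++ t); last by rewrite big_cat s1 t1 /= mulg1.
by rewrite perm_sym (perm_trans (perm_msetD S T)) // perm_sym perm_cat.
Qed.

Lemma factorizations0 : factorizations (mset0 : {mset gT}) mset0.
Proof. by split; [move=> A; rewrite in_mset0|exact: msum0]. Qed.

Lemma factorizations_cons A S z : atoms A -> factorizations S z ->
  factorizations (A `+` S) (A +` z).
Proof.
move=> atA [atz zS]; split; first by move=> B; rewrite in_mset1D => /predU1P [->|/atz].
by rewrite -/(msum _) msumD msum1 -zS.
Qed.

Lemma factorizationsD S T z z' : factorizations S z -> factorizations T z' ->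
  factorizations (S `+` T) (z `+` z').
Proof.
move=> [atz zS] [atz' zT]; split; last by rewrite -/(msum _) msumD -zS -zT.
by move=> B; rewrite in_msetD => /orP [/atz|/atz'].
Qed.

Lemma factorizations1 A : atoms A -> factorizations A [mset A].
Proof.
by move=> atA; have := factorizations_cons atA factorizations0; rewrite !msetD0.
Qed.

Lemma factorizations_uncons A S z : factorizations S (A +` z) ->
  [/\ atoms A, factorizations (msum z) z & S = A `+` msum z].
Proof.
move=> [atz zS]; split; first by apply: atz; rewrite mset1D1.
  by split => // B Bz; apply: atz; rewrite in_mset1D Bz orbT.
by rewrite -zS -/(msum _) msumD msum1.
Qed.

Lemma factorizations_split A S z : factorizations S z -> A \in z ->
  exists T w, [/\ z = A +` w, S = A `+` T & factorizations T w].
Proof.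
move=> fz Az; exists (msum (z `\ A)), (z `\ A).
have zE := msub_mem Az; rewrite zE in fz.
by have [_ ? ?] := factorizations_uncons fz; split.
Qed.

Lemma atoms_neq0 A : atoms A -> A != mset0.
Proof. by case. Qed.

Lemma atoms_product_one A : atoms A -> product_one A.
Proof. by case. Qed.

Lemma mset_ind_size (P : {mset gT} -> Prop) :
  (forall S, (forall T, size T < size S -> P T) -> P S) -> forall S, P S.
Proof.
move=> IH S; have [n] := ubnP (size S); elim: n S => // n IHn S ltSn.
by apply: IH => T ltTS; apply: IHn; lia.
Qed.

Lemma factorizations_product_one S z : factorizations S z -> product_one S.
Proof.
move=> [atz <-]; rewrite -/(msum z) /msum.
have {atz}: forall A, A \in (z : seq _) -> atoms A by exact: atz.
elim: (z : seq _) => [|A s IHs] ats; first by rewrite big_nil; exact: product_one0.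
rewrite big_cons; apply: product_oneD.
  by apply: atoms_product_one; apply: ats; rewrite inE eqxx.
by apply: IHs => B Bs; apply: ats; rewrite inE Bs orbT.
Qed.

Lemma factorizations_exist S : product_one S -> exists z, factorizations S z.
Proof.
elim/mset_ind_size: S => S IH poS.
have [->|S0] := eqVneq S mset0; first by exists mset0; exact: factorizations0.
have [atS|natS] := pselect (atoms S); first by exists [mset S]; exact: factorizations1.
have /contrapT [T [U [poT poU T0 U0 SE]]] : ~ ~ exists T U : {mset gT},
    [/\ product_one T, product_one U, T != mset0, U != mset0 & S = T `+` U].
  by move=> nTU; apply: natS; split.
rewrite SE in IH *.
rewrite -!mset_size_gt0 in T0 U0.
have [|z fz] := IH T _ poT; first by rewrite size_msetD; lia.
have [|z' fz'] := IH U _ poU; first by rewrite size_msetD; lia.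
by exists (z `+` z'); exact: factorizationsD.
Qed.

Lemma factorizations_mset0 z : factorizations mset0 z -> z = mset0.
Proof.
move=> fz; have [//|[A Az]] := mset0_or_mem z.
have [T [w [_ E _]]] := factorizations_split fz Az.
have := congr1 (fun B : {mset gT} => size B) E; rewrite size_msetD size_mset0.
have [fA _] := fz; have := atoms_neq0 (fA _ Az); rewrite -mset_size_gt0; lia.
Qed.

Lemma atom_dvd A T U : atoms A -> product_one T -> product_one U ->
  A = T `+` U -> T = mset0 \/ U = mset0.
Proof.
move=> [_ _ nA] poT poU E; have [->|T0] := eqVneq T mset0; first by left.
have [->|U0] := eqVneq U mset0; first by right.
by case: nA; exists T, U; split.
Qed.

Lemma factorizations_atom A z : atoms A -> factorizations A z -> z = [mset A].
Proof.
move=> atA fz; have [z0|[B Bz]] := mset0_or_mem z.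
  by move: fz (atoms_neq0 atA); rewrite z0 => -[_]; rewrite big_mset0 => <-; rewrite eqxx.
have [T [w [zE AE fw]]] := factorizations_split fz Bz.
have atB : atoms B by case: fz => + _; apply.
have := atom_dvd atA (atoms_product_one atB) (factorizations_product_one fw) AE.
case=> [B0|T0]; first by move: (atoms_neq0 atB); rewrite B0 eqxx.
by rewrite T0 in fw AE; rewrite zE (factorizations_mset0 fw) AE !msetD0.
Qed.

End Products.

(** * Minima and suprema of extended integers *)

Section Bounds.

Local Open Scope classical_set_scope.

Lemma set_minP d (T : porderType d) (x0 : T) (A : set T) :
  (exists m, A m /\ lbound A m) -> A (set_min x0 A) /\ lbound A (set_min x0 A).
Proof.
by move=> [m Am]; have := @xgetPex _ x0 (A `&` lbound A) (ex_intro _ m Am).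
Qed.

Lemma nat_set_min (P : nat -> Prop) n : P n ->
  exists2 m, P m & forall k, P k -> m <= k.
Proof.
move=> Pn; have exP : exists k, `[< P k >] by exists n; apply/asboolP.
have [m /asboolP Pm minm] := ex_minnP exP.
by exists m => // k Pk; apply/minm/asboolP.
Qed.

(** The nonnegative part of the extended integers is well ordered, which makes
    the minima and suprema in the definitions of the invariants attained. *)
Lemma ebar_int_min (A : set (\bar int)) : A !=set0 ->
  (forall x, A x -> (0 <= x)%E) -> exists m, A m /\ lbound A m.
Proof.
move=> [a Aa] A0; have [[n An]|nA] := pselect (exists n : nat, A n%:Z%:E).
  have [m Am minm] := nat_set_min (P := fun n : nat => A n%:Z%:E) An.
  exists m%:Z%:E; split=> // -[[k|k]||] Ak; rewrite ?leey //; have := A0 _ Ak => //.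
  by move=> _; rewrite lee_fin lez_nat minm.
exists a; split=> // x Ax; suff -> : x = +oo%E by rewrite leey.
case: x Ax => [[k|k]||] // Ax; have := A0 _ Ax => //.
by case: nA; exists k.
Qed.

Lemma supremum_leP (A : set (\bar int)) (M : \bar int) : A !=set0 ->
  (forall x, A x -> (0 <= x)%E) -> ((supremum 0%E A <= M)%E <-> ubound A M).
Proof.
move=> A0 Age0; have [m [um lm]] : exists m, ubound A m /\ lbound (ubound A) m.
  apply: ebar_int_min; first by exists +oo%E => x _; rewrite leey.
  by case: A0 => a Aa x ux; exact: le_trans (Age0 _ Aa) (ux _ Aa).
have [us ls] : supremums A (supremum 0%E A).
  rewrite /supremum ifF; last by apply/negP => /eqP E; case: A0 => a; rewrite E.
  have := @xgetPex _ 0%E (supremums A); apply; by exists m.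
split=> [leM x Ax|uM]; last exact: ls.
exact: le_trans (us _ Ax) leM.
Qed.

End Bounds.

(** * Distances of factorizations and gaps in sets of lengths *)

Section Distance.

Variable gT : finGroupType.
Implicit Types (A B S T U V : {mset gT}) (z w : {mset {mset gT}}).

Lemma lengthsP S n : lengths S n%:Z <-> exists2 z, factorizations S z & size z = n.
Proof.
by split=> -[z fz E]; exists z => //; [case: E|rewrite E].
Qed.

Lemma lengths_nat S l : lengths S l -> exists n : nat, l = n%:Z.
Proof. by move=> [z _ <-]; eexists. Qed.

Lemma fact_distE z w : fact_dist z w = maxn (size (z `\` w)) (size (w `\` z)).
Proof.
by rewrite /fact_dist; congr maxn; congr (size (enum_mset _)); apply/msetP => x;
  rewrite !msetE2; lia.
Qed.

Lemma fact_distC z w : fact_dist z w = fact_dist w z.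
Proof. by rewrite !fact_distE maxnC. Qed.

Lemma fact_dist_add v z w : fact_dist (v `+` z) (v `+` w) = fact_dist z w.
Proof. by rewrite !fact_distE !msetBDl. Qed.

Lemma fact_dist_le z w : fact_dist z w <= maxn (size z) (size w).
Proof.
by rewrite fact_distE geq_max !leq_max !(size_msub (msubsetDl _ _)) ?orbT.
Qed.

(** After cancelling the common part, the two factorizations are of the same
    sequence T. If the shorter one consists of a single atom, then T is that
    atom and its only factorization is itself; so the shorter one has at least
    two atoms. *)
Lemma fact_dist_gap S z w : factorizations S z -> factorizations S w ->
  size z < size w -> (size w - size z).+2 <= fact_dist z w.
Proof.
move=> [atz zS] [atw wS] lt_zw.
have zE : z = (z `&` w) `+` (z `\` w) by apply/msetP => x; rewrite !msetE2; lia.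
have wE : w = (z `&` w) `+` (w `\` z) by apply/msetP => x; rewrite !msetE2; lia.
have sz : size z = size (z `&` w) + size (z `\` w) by rewrite {1}zE size_msetD.
have sw : size w = size (z `&` w) + size (w `\` z) by rewrite {1}wE size_msetD.
have fy : factorizations (msum (z `\` w)) (z `\` w).
  by split=> // A /(msubset_subset (msubsetDl _ _))/atz.
have fy' : factorizations (msum (z `\` w)) (w `\` z).
  split=> [A /(msubset_subset (msubsetDl _ _))/atw //|].
  apply: (@msetDI _ (msum (z `&` w))); rewrite -/(msum _) -!msumD -zE -wE.
  by rewrite /msum zS.
have : 1 < size (z `\` w).
  rewrite ltnNge; apply/negP => le1; suff E : z `\` w = w `\` z.
    by move: lt_zw; rewrite sz sw E ltnn.
  have [y0|[A Ay]] := mset0_or_mem (z `\` w).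
    by move: fy'; rewrite y0 msum0 => /factorizations_mset0 ->.
  have yE := msub_mem Ay; have : size ((z `\` w) `\ A) = 0.
    by move: le1; rewrite {1}yE size_mset_cons; lia.
  move=> /mset_size0 y0; rewrite y0 msetD0 in yE.
  have atA : atoms A by case: fy => + _; apply.
  by move: fy'; rewrite yE msum1 => /(factorizations_atom atA) ->.
rewrite fact_distE; lia.
Qed.

Definition linked S N z w : Prop :=
  exists s : seq {mset {mset gT}}, [/\ forall v, v \in s -> factorizations S v,
    path (fun u v => fact_dist u v <= N) z s & last z s = w].

Lemma chain_connectedP S (N : nat) : chain_connected S N%:Z%:E <->
  forall z w, factorizations S z -> factorizations S w -> linked S N z w.
Proof.
have eqp u s : path (fun u v : {mset {mset gT}} => ((fact_dist u v)%:Z%:E <= N%:Z%:E)%E) u s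
    = path (fun u v => fact_dist u v <= N) u s.
  by apply: eq_path => a b; rewrite lee_fin lez_nat.
by split=> cc z w fz fw; have [s [fs ps ls]] := cc z w fz fw; exists s; split=> //;
  rewrite ?eqp // -eqp.
Qed.

Lemma linked_refl S N z : linked S N z z.
Proof. by exists [::]; split. Qed.

Lemma linked_trans S N z w v : linked S N z w -> linked S N w v -> linked S N z v.
Proof.
move=> [s [fs ps ls]] [t [ft pt lt]]; exists (s ++ t); split.
- by move=> u; rewrite mem_cat => /orP [/fs|/ft].
- by rewrite cat_path ps ls.
- by rewrite last_cat ls.
Qed.

Lemma linked_step S N z w : factorizations S w -> fact_dist z w <= N ->
  linked S N z w.
Proof.
by move=> fw le; exists [:: w]; split=> //=; [move=> v; rewrite inE => /eqP ->|rewrite le].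
Qed.

Lemma linked_sym S N z w : factorizations S z -> linked S N z w -> linked S N w z.
Proof.
move=> fz [s [fs ps <-]]; elim: s z fz fs ps => [|v s IHs] z fz fs /=.
  by move=> _; exact: linked_refl.
move=> /andP [le_zv ps]; apply: (@linked_trans _ _ _ v).
  apply: IHs => //; first by apply: fs; rewrite mem_head.
  by move=> u us; apply: fs; rewrite inE us orbT.
by apply: linked_step => //; rewrite fact_distC.
Qed.

Lemma linked_cons A S N z w : atoms A -> linked S N z w ->
  linked (A `+` S) N (A +` z) (A +` w).
Proof.
move=> atA [s [fs ps <-]]; exists [seq A +` v | v <- s]; split.
- by move=> _ /mapP [v /fs fv ->]; exact: factorizations_cons.
- rewrite path_map; apply: sub_path ps => u v /=; by rewrite fact_dist_add.
- by rewrite last_map.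
Qed.

Lemma distances_linked S N z (l d : nat) s :
    factorizations S z -> size z <= l -> (forall v, v \in s -> factorizations S v) ->
    path (fun u v => fact_dist u v <= N) z s -> l + d <= size (last z s) -> 0 < d ->
    (forall v, factorizations S v -> size v <= l \/ l + d <= size v) ->
  d + 2 <= N.
Proof.
move=> + + + + + d0 gap; elim: s z => [|v s IHs] z fz le_zl fs /=.
  by move=> _ le; move: (leq_trans le le_zl); lia.
move=> /andP [le_zv ps] lel.
have fv : factorizations S v by apply: fs; rewrite mem_head.
have [le_vl|le_lv] := gap _ fv.
  by apply: (IHs v) => // u us; apply: fs; rewrite inE us orbT.
have := fact_dist_gap fz fv; lia.
Qed.

(** Along a chain the lengths must at some step jump over the gap from l to
    l + d, and [fact_dist_gap] bounds the distance of that step from below. *)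
Lemma distances_le S (N : nat) d :
  chain_connected S N%:Z%:E -> distances (lengths S) d -> (d + 2 <= N%:Z)%R.
Proof.
move=> /chain_connectedP cc [d0 [l Ll E]].
have [n ln] := lengths_nat Ll; have [e de] : exists e : nat, d = e%:Z.
  by exists `|d|%N; rewrite gtz0_abs.
subst l d.
have [z fz sz] := (lengthsP S n).1 Ll.
have : lengths S (n + e)%N%:Z.
  have : [set n%:Z; n%:Z + e%:Z]%R%classic (n%:Z + e%:Z)%R by right.
  by rewrite -E => -[+ _]; rewrite PoszD.
move=> /lengthsP [w fw sw].
have [s [fs ps ls]] := cc z w fz fw.
have := @distances_linked S N z n e s fz.
rewrite ls sz sw => H; suff : e + 2 <= N by lia.
apply: H => // v fv.
have [lt|?] := ltnP n (size v); last by left.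
have [le|lt'] := leqP (n + e) (size v); first by right.
exfalso; have : [set n%:Z; n%:Z + e%:Z]%R%classic (size v)%:Z.
  rewrite -E; split; first by exists v.
  by rewrite /= in_itv /= -PoszD !lez_nat (ltnW lt) (ltnW lt').
by rewrite /= -PoszD => -[] [E']; move: lt lt'; rewrite E' ltnn.
Qed.

Lemma distances_connected2 S d :
  chain_connected S 2%N%:Z%:E -> ~ distances (lengths S) d.
Proof.
move=> cc dS; have := distances_le cc dS; rewrite -[leRHS]add0r lerD2r.
by case: dS => d0 _ /(lt_le_trans d0); rewrite ltxx.
Qed.

Lemma distances_connected3 S d :
  chain_connected S 3%N%:Z%:E -> distances (lengths S) d -> d = 1%R.
Proof.
move=> cc dS; have := distances_le cc dS; case: dS => d0 _ le.
by apply/eqP; rewrite eq_le -gtz0_ge1 d0 andbT -(lerD2r 2%R).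
Qed.

Lemma distances_next S (l m : nat) : lengths S l%:Z -> lengths S m%:Z -> l < m ->
  exists n : nat, [/\ l < n, n <= m, lengths S n%:Z
    & distances (lengths S) (n%:Z - l%:Z)%R].
Proof.
move=> Ll Lm ltlm.
have [n [ltln Ln] minn] := nat_set_min (P := fun n => l < n /\ lengths S n%:Z) (conj ltlm Lm).
exists n; split=> //; first exact: minn.
split; first by lia.
exists l%:Z => //; rewrite addrC subrK; apply/seteqP; split=> x.
  move=> [Lx] /=; have [k xk] := lengths_nat Lx; subst x.
  rewrite in_itv /= !lez_nat => /andP [le_lk le_kn].
  move: le_lk; rewrite leq_eqVlt => /predU1P [->|lt]; first by left.
  by right; have := minn k (conj lt Lx) => ?; congr Posz; lia.
by case=> ->; split=> //=; rewrite in_itv /= !lez_nat leqnn (ltnW ltln).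
Qed.

(** The lengths 0 and 1 occur only for the empty sequence and for atoms, whose
    factorizations are unique. *)
Lemma lengths_ge2 S (n : nat) : lengths S 2 -> lengths S n%:Z -> 2 <= n.
Proof.
move=> /(lengthsP S 2) [z fz sz] /lengthsP [w fw sw].
case: n sw => [|[|n]] // sw; exfalso.
  have S0 : S = mset0 by case: fw => _ <-; rewrite (mset_size0 sw) big_mset0.
  by rewrite S0 in fz; move: sz; rewrite (factorizations_mset0 fz) size_mset0.
have [w0|[A Aw]] := mset0_or_mem w; first by rewrite w0 size_mset0 in sw.
have [T [v [wE SE fv]]] := factorizations_split fw Aw.
have v0 : v = mset0 by apply: mset_size0; move: sw; rewrite wE size_mset_cons; lia.
have T0 : T = mset0 by case: fv => _ <-; rewrite v0 big_mset0.
have atA : atoms A by case: fw => + _; apply.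
rewrite SE T0 msetD0 in fz; move: sz.
by rewrite (factorizations_atom atA fz) enum_msetn size_nseq.
Qed.

End Distance.

(** * The catenary degree and daleth *)

Section Invariants.

Variable gT : finGroupType.
Implicit Types (A B S T U V : {mset gT}) (z w : {mset {mset gT}}).

Lemma chain_connected_pinfty S : chain_connected S +oo%E.
Proof.
move=> z w fz fw; exists [:: w]; split=> //.
by move=> v; rewrite inE => /eqP ->.
Qed.

Lemma catenary_elt_ge0 S : (0 <= catenary_elt S)%E.
Proof.
rewrite /catenary_elt; have [] // := set_minP +oo%E
  (A := [set N | (0 <= N)%E /\ chain_connected S N]%classic).
  apply: ebar_int_min; last by move=> x [].
  by exists +oo%E; split=> //; exact: chain_connected_pinfty.
by move=> [].
Qed.

Lemma catenary_elt_leP S (M : nat) :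
  (catenary_elt S <= M%:Z%:E)%E <-> chain_connected S M%:Z%:E.
Proof.
rewrite /catenary_elt; have [] := set_minP +oo%E
  (A := [set N | (0 <= N)%E /\ chain_connected S N]%classic).
  apply: ebar_int_min; last by move=> x [].
  by exists +oo%E; split=> //; exact: chain_connected_pinfty.
set c := set_min _ _ => -[c0 cc] lc; split=> [leM|ccM]; last first.
  by apply: lc; split.
move=> z w fz fw; have [s [fs ps ls]] := cc z w fz fw; exists s; split=> //.
by apply: sub_path ps => u v le; exact: le_trans le leM.
Qed.

Lemma catenary_degree_leP (M : nat) : (catenary_degree gT <= M%:Z%:E)%E <->
  forall S, product_one S -> chain_connected S M%:Z%:E.
Proof.
rewrite /catenary_degree supremum_leP.
- split=> [uM S poS|cc _ [S poS <-]]; last by apply/catenary_elt_leP/cc.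
  by apply/catenary_elt_leP/uM; exists S.
- by exists (catenary_elt (mset0 : {mset gT})), mset0 => //; exact: product_one0.
- by move=> _ [S _ <-]; exact: catenary_elt_ge0.
Qed.

Lemma catenary_degree_eq3 : catenary_degree gT = 3%:E <->
  (catenary_degree gT <= 3%:E)%E /\ ~ (catenary_degree gT <= 2%:E)%E.
Proof.
split=> [->|[le3 nle2]]; first by [].
case: (catenary_degree gT) le3 nle2 => [r||] //.
by rewrite !lee_fin => le3 nle2; congr EFin; lia.
Qed.

(** The condition that daleth is at most 3, expressed by sets of lengths. *)
Definition reaches3 := forall S (n : nat),
  lengths S 2 -> lengths S n%:Z -> n <> 2 -> lengths S 3.

Definition has_relation S := lengths S 2 /\ exists2 n : nat, lengths S n%:Z & n <> 2.

Lemma set_min_lengths S : has_relation S -> exists n : nat,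
  [/\ set_min 0%R (lengths S `\ 2%R)%classic = n%:Z, 2 < n, lengths S n%:Z
    & forall m : nat, lengths S m%:Z -> m <> 2 -> n <= m].
Proof.
move=> [L2 [k Lk k2]].
have [n [Ln n2] minn] := nat_set_min (P := fun n => lengths S n%:Z /\ n <> 2) (conj Lk k2).
have nmin : (exists m : int, (lengths S `\ 2%R)%classic m /\ lbound (lengths S `\ 2%R)%classic m).
  exists n%:Z; split; first by split=> //=; case.
  move=> x [Lx x2]; have [m xm] := lengths_nat Lx; subst x; rewrite lez_nat.
  by apply: minn; split=> // m2; apply: x2; rewrite m2.
have [[Lm m2] lm] := set_minP 0%R nmin.
have [m mE] := lengths_nat Lm; rewrite {}mE in Lm m2 lm *.
have mn : m = n.
  apply/eqP; rewrite eqn_leq minn ?andbT; last by split=> // E; apply: m2; rewrite E.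
  by rewrite -lez_nat; apply: lm; split=> //=; case.
subst m; exists n; split=> //; first by have := lengths_ge2 L2 Ln; lia.
by move=> m Lm' m2'; exact: minn.
Qed.

Lemma lengths_product_one S l : lengths S l -> product_one S.
Proof. by move=> [z fz _]; exact: factorizations_product_one fz. Qed.

Lemma distances_delta S d : product_one S -> distances (lengths S) d -> delta gT d.
Proof. by move=> poS dS; exists S. Qed.

Lemma has_relation_distance S : has_relation S ->
  exists2 d, distances (lengths S) d & product_one S.
Proof.
move=> rS; have [n [_ lt2 Ln _]] := set_min_lengths rS; have [L2 _] := rS.
have [m [_ _ _ dm]] := distances_next (L2 : lengths S 2%N%:Z) Ln lt2.
by exists (m%:Z - 2%N%:Z)%R => //; exact: lengths_product_one L2.
Qed.

Lemma reaches3_of_distance S (n : nat) : lengths S 2 -> lengths S n%:Z -> n <> 2 ->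
  (forall d, distances (lengths S) d -> d = 1%R) -> lengths S 3.
Proof.
move=> L2 Ln n2 dist1; have ge2 := lengths_ge2 L2 Ln.
have lt2 : 2 < n by rewrite ltn_neqAle eq_sym ge2 andbT; apply/eqP.
have [m [_ _ Lm /dist1 /eqP]] := distances_next (L2 : lengths S 2%N%:Z) Ln lt2.
by rewrite subr_eq => /eqP mE; rewrite mE in Lm.
Qed.

(** A sequence without a relation contributes the value 0 assigned to the minimum
    of the empty set. *)
Lemma daleth_eq3 : daleth gT = 3%:E <-> reaches3 /\ exists S, has_relation S.
Proof.
set D := [set (set_min 0%R (lengths S `\ 2%R)%classic)%:E
       | S in [set S : {mset gT} | product_one S /\ lengths S 2%R]]%classic.
have triv S : product_one S /\ lengths S 2 -> has_relation S \/ set_min 0%R (lengths S `\ 2%R)%classic = 0%R.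
  move=> [poS L2]; have [?|nr] := pselect (has_relation S); [by left|right].
  rewrite /set_min xgetPN // => x [[Lx x2] _]; apply: nr; split=> //.
  have [n xn] := lengths_nat Lx; subst x; exists n => // n2; apply: x2.
  by rewrite n2.
have D0 x : D x -> (0 <= x)%E.
  move=> [S /triv [/set_min_lengths [n [-> _ _ _]]|->] <-]; rewrite lee_fin //.
rewrite /daleth -/D; split=> [sup3|[r3 [S0 rS0]]].
  have Dn0 : D !=set0%classic.
    by apply/set0P/negP => /eqP E; move: sup3; rewrite E supremum0.
  have ub : ubound D 3%:E by apply/supremum_leP => //; rewrite sup3.
  split=> [S n L2 Ln n2|].
    have rS : has_relation S by split=> //; exists n.
    have [m [mE lt2m Lm _]] := set_min_lengths rS.
    have : (m%:Z%:E <= 3%:E)%E.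
      by rewrite -mE; apply: ub; exists S => //; split=> //; exact: lengths_product_one Ln.
    by rewrite lee_fin => le3; have <- : m = 3 by lia.
  apply: contrapT => nr; have : (supremum 0%E D <= 2%:E)%E.
    apply/supremum_leP => // x [S /triv [rS|->] <-] //.
    by case: nr; exists S.
  by rewrite sup3.
have dS S : has_relation S -> set_min 0%R (lengths S `\ 2%R)%classic = 3%R.
  move=> rS; have [n [-> lt2n Ln minn]] := set_min_lengths rS.
  have [L2 [k Lk k2]] := rS.
  have le3 : n <= 3 by apply: minn => //; exact: r3 L2 Lk k2.
  by have -> : n = 3 by lia.
have D3 : D 3%:E.
  have [L2 _] := rS0; exists S0; last by rewrite dS.
  by split=> //; exact: lengths_product_one L2.
apply/eqP; rewrite eq_le; apply/andP; split.
  apply/supremum_leP => //; first by exists 3%:E.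
  by move=> x [S /triv [/dS ->|->] <-].
have [] // := @supremum_leP D (supremum 0%E D); first by exists 3%:E.
by move=> /(_ (lexx _)) /(_ _ D3).
Qed.

End Invariants.

(** * Chains of factorizations over abelian groups *)

(** If the first atom A is not the required U, then it contains a term of W, so
    W without A has fewer terms and one atom less is available. *)
Lemma msum_cover (gT : finGroupType) (W : {mset gT}) (z : {mset {mset gT}}) :
  W `<=` msum z -> size W < size z ->
  exists2 U, U \in z & W `<=` msum (z `\ U).
Proof.
have [n] := ubnP (size z); elim: n z W => // n IHn z W ltzn sWz ltWz.
have [z0|[A Az]] := mset0_or_mem z; first by rewrite z0 size_mset0 in ltWz.
have [w zE wE] : exists2 w, z = A +` w & z `\ A = w.
  by exists (z `\ A) => //; exact: msub_mem.
have szE : size z = (size w).+1 by rewrite zE size_mset_cons.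
have sumE : msum z = A `+` msum w by rewrite zE msumD msum1.
have [sWw|nsWw] := boolP (W `<=` msum w); first by exists A; rewrite ?wE.
have ltWA : size (W `\` A) < size W.
  have WE : W = (W `\` A) `+` (W `&` A) by apply/msetP => x; rewrite !msetE2; lia.
  rewrite [in X in _ < X]WE size_msetD -[ltnLHS]addn0 ltn_add2l mset_size_gt0.
  apply: contraNN nsWw => /eqP WA0; apply/msubsetP => x.
  move: sWz => /msubsetP/(_ x); rewrite sumE msetE2.
  by have := congr1 (fun B : {mset gT} => B x) WA0; rewrite msetE2 mset0E; lia.
have [|||U Uw sWU] := IHn w (W `\` A); [lia| |lia|].
  by rewrite subset_msetBLR -sumE.
exists U; first by rewrite zE in_mset1D Uw orbT.
have -> : z `\ U = A +` (w `\ U).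
  apply/msetP => x; rewrite zE !msetE2 !msetnE.
  by have := Uw; rewrite in_mset; case: (eqVneq x U) => [->|]; lia.
by rewrite msumD msum1 -subset_msetBLR.
Qed.

Section Abelian.

Variable gT : finGroupType.
Implicit Types (A B S T U V W : {mset gT}) (z w : {mset {mset gT}}).

Hypothesis abelG : forall x y : gT, commute x y.

Lemma prod_perm (s t : seq gT) :
  perm_eq s t -> (\prod_(x <- s) x = \prod_(x <- t) x)%g.
Proof.
move=> st; apply: (catCA_perm_ind (P := fun t => (\prod_(x <- s) x = \prod_(x <- t) x)%g)) st _ => //.
by move=> s1 s2 s3 ->; rewrite !big_cat /= !mulgA; congr mulg; exact: abelG.
Qed.

Lemma product_one_abelP (s : seq gT) (S : {mset gT}) : perm_eq s S ->
  product_one S <-> (\prod_(x <- s) x = 1)%g.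
Proof.
move=> sS; split=> [[t tS t1]|s1]; last by exists s.
by rewrite (@prod_perm s t) // (perm_trans sS) // perm_sym.
Qed.

(** This step fails over nonabelian groups, and it is the reason why the bound
    below is restricted to abelian ones. *)
Lemma product_one_cancel S T :
  product_one (S `+` T) -> product_one S -> product_one T.
Proof.
move=> poST poS; apply/(product_one_abelP (perm_refl T)).
have : perm_eq (S ++ T) (S `+` T) by rewrite perm_sym perm_msetD.
move=> /product_one_abelP [+ _] => /(_ poST); rewrite big_cat /=.
by have [/(_ poS) -> _] := product_one_abelP (perm_refl S); rewrite mul1g.
Qed.

(** The induction runs over the size of S. Two factorizations that share an atom
    are linked by the induction hypothesis ([share]). If z has more than N atoms
    and z' contains an atom W of size at most N, then W is covered by z without
    some atom U, so that U and W occur together in a factorization, which is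
    linked to z through U and to z' through W ([short]). If all atoms of z' are
    longer than N, the hypothesis replaces two of them by a factorization with a
    short atom, to which [short] applies, and which either is close to z' or shares an
    atom with it ([long]). *)
Lemma chain_connected_abel (N : nat) : 1 < N ->
  (forall A B, atoms A -> atoms B -> N < size A -> N < size B ->
     exists z, [/\ factorizations (A `+` B) z, size z <= N
       & exists2 W : {mset gT}, W \in z & size W <= N]) ->
  forall S, chain_connected S N%:Z%:E.
Proof.
move=> N1 HN; elim/mset_ind_size => S IH; apply/chain_connectedP.
have share A y y' : factorizations S (A +` y) -> factorizations S (A +` y') ->
    linked S N (A +` y) (A +` y').
  move=> /factorizations_uncons [atA fy SE] /factorizations_uncons [_ fy' SE'].
  rewrite SE; apply: linked_cons => //.
  have E : msum y' = msum y by apply: (@msetDI _ A); rewrite -SE -SE'.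
  have ltS : size (msum y) < size S.
    by rewrite SE size_msetD; have := atoms_neq0 atA; rewrite -mset_size_gt0; lia.
  by have /chain_connectedP := IH _ ltS; apply => //; rewrite -E.
have short z z' W : factorizations S z -> factorizations S z' -> N < size z ->
    W \in z' -> size W <= N -> linked S N z z'.
  move=> fz fz' ltNz Wz' leWN.
  have [T [w' [z'E SE fw']]] := factorizations_split fz' Wz'.
  have sWz : W `<=` msum z by case: fz => _; rewrite -/(msum z) => ->; rewrite SE msub_addl.
  have [U Uz sWU] := msum_cover sWz (leq_ltn_trans leWN ltNz).
  have [T' [w [zE SE' fw]]] := factorizations_split fz Uz.
  have wE : z `\ U = w by rewrite zE msetD1K.
  have atW : atoms W by case: fz' => + _; apply.
  have atU : atoms U by case: fz => + _; apply.
  have [_ wT'] := fw; rewrite -/(msum w) in wT'.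
  rewrite wE wT' in sWU.
  have [y fy] : exists y, factorizations (T' `\` W) y.
    apply: factorizations_exist; apply: (@product_one_cancel W).
      by rewrite -(msubD sWU); exact: factorizations_product_one fw.
    exact: atoms_product_one.
  have fWy : factorizations T' (W +` y) by rewrite (msubD sWU); exact: factorizations_cons.
  have fv : factorizations S (U +` (W +` y)) by rewrite SE'; exact: factorizations_cons.
  apply: (@linked_trans _ _ _ _ (U +` (W +` y))).
    by rewrite zE; apply: share; rewrite -?zE.
  have vE := msetDCA [mset U] [mset W] y.
  by rewrite vE z'E; apply: share; rewrite -?vE -?z'E.
have long z z' : factorizations S z -> factorizations S z' -> N < size z ->
    linked S N z z'.
  move=> fz fz' ltNz.
  have [[W Wz' leW]|nW] := pselect (exists2 W : {mset gT}, W \in z' & size W <= N).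
    exact: short leW.
  have ltNW W : W \in z' -> N < size W.
    by move=> Wz'; rewrite ltnNge; apply/negP => leW; apply: nW; exists W.
  have [z0|[A Az]] := mset0_or_mem z'.
    move: fz' fz ltNz; rewrite z0 => -[_]; rewrite big_mset0 => <-.
    by move=> /factorizations_mset0 ->; rewrite size_mset0.
  have [T [w [z'E SE fw]]] := factorizations_split fz' Az.
  have atA : atoms A by case: fz' => + _; apply.
  have [w0|[B Bw]] := mset0_or_mem w.
    have T0 : T = mset0 by case: fw => _ <-; rewrite w0 big_mset0.
    move: fz ltNz; rewrite SE T0 msetD0 => /(factorizations_atom atA) ->.
    by rewrite enum_msetn size_nseq; lia.
  have [T' [v [wE TE fv]]] := factorizations_split fw Bw.
  have Bz : B \in z' by rewrite z'E in_mset1D Bw orbT.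
  have atB : atoms B by case: fz' => + _; apply.
  have [y [fy ley [W Wy leW]]] := HN A B atA atB (ltNW _ Az) (ltNW _ Bz).
  have fyv : factorizations S (y `+` v).
    by rewrite SE TE msetDA; exact: factorizationsD.
  have Wyv : W \in y `+` v by rewrite in_msetD Wy.
  apply: linked_trans (short _ _ _ fz fyv ltNz Wyv leW) _.
  have [v0|[C Cv]] := mset0_or_mem v.
    apply: linked_step => //; rewrite (leq_trans (fact_dist_le _ _)) //.
    by rewrite v0 msetD0 geq_max ley z'E wE v0 msetD0 size_mset_cons enum_msetn.
  have [u vE] : exists u, v = C +` u by exists (v `\ C); exact: msub_mem.
  have yvE : y `+` v = C +` (y `+` u) by rewrite vE (msetDCA y [mset C]).
  have z'CE : z' = C +` (A +` (B +` u)).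
    by rewrite z'E wE vE (msetDCA [mset B] [mset C]) (msetDCA [mset A] [mset C]).
  by rewrite yvE z'CE; apply: share; rewrite -?yvE -?z'CE.
move=> z w fz fw; have [ltNz|lezN] := ltnP N (size z); first exact: long.
have [ltNw|lewN] := ltnP N (size w).
  by apply: linked_sym => //; exact: long.
by apply: linked_step => //; rewrite (leq_trans (fact_dist_le _ _)) // geq_max lezN.
Qed.

End Abelian.

(** * Sequences over a finite support as exponent vectors *)

Fixpoint expand {T : Type} (gs : seq T) (v : seq nat) : seq T :=
  match gs, v with
  | g :: gs', n :: v' => nseq n g ++ expand gs' v'
  | _, _ => [::]
  end.

Fixpoint subvecs (v : seq nat) : seq (seq nat) :=
  if v is n :: v' then [seq i :: w | i <- iota 0 n.+1, w <- subvecs v'] else [:: [::]].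

Fixpoint vadd (v w : seq nat) : seq nat :=
  match v, w with n :: v', m :: w' => n + m :: vadd v' w' | _, _ => [::] end.

Fixpoint vsub (v w : seq nat) : seq nat :=
  match v, w with n :: v', m :: w' => n - m :: vsub v' w' | _, _ => [::] end.

Definition vzero (v : seq nat) := all (pred1 0) v.

Definition vsum n (vs : seq (seq nat)) := foldr vadd (nseq n 0) vs.

Lemma map_expand (T T' : Type) (f : T -> T') gs v :
  expand (map f gs) v = map f (expand gs v).
Proof.
by elim: gs v => [|g gs IH] [|n v] //=; rewrite map_cat map_nseq IH.
Qed.

Lemma subvecsP n v' w : w \in subvecs (n :: v') ->
  exists i w', [/\ w = i :: w', i <= n & w' \in subvecs v'].
Proof.
move=> /allpairsP [[i w'] [+ w'v' ->]]; rewrite mem_iota add0n ltnS => /andP [_ le].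
by exists i, w'.
Qed.

Lemma mem_subvecs n v i w :
  i <= n -> w \in subvecs v -> i :: w \in subvecs (n :: v).
Proof.
move=> le_in wv; apply: (allpairs_f (fun j u => j :: u)) wv.
by rewrite mem_iota add0n ltnS.
Qed.

Lemma size_subvec v w : w \in subvecs v -> size w = size v.
Proof.
elim: v w => [|n v IH] w; first by rewrite inE => /eqP ->.
by move=> /subvecsP [i [w' [-> _ /IH /= ->]]].
Qed.

Lemma size_vsub v w : size v = size w -> size (vsub v w) = size v.
Proof. by elim: v w => [|n v IH] [|m w] //= [/IH ->]. Qed.

Lemma size_vadd v w : size v = size w -> size (vadd v w) = size v.
Proof. by elim: v w => [|n v IH] [|m w] //= [/IH ->]. Qed.

Lemma size_vsub_sub v w : w \in subvecs v -> size (vsub v w) = size v.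
Proof. by move=> wv; rewrite size_vsub // (size_subvec wv). Qed.

Section Vectors.

Variables (gT : finGroupType).
Implicit Types (gs : seq gT) (v w : seq nat) (A B C S T U : {mset gT}).

Definition mset_vec gs v : {mset gT} := seq_mset (expand gs v).

Lemma mset_vec_cons g gs n v :
  mset_vec (g :: gs) (n :: v) = msetn n g `+` mset_vec gs v.
Proof. by rewrite /mset_vec /= seq_mset_cat seq_mset_nseq. Qed.

Lemma size_mset_vec gs v : size v = size gs -> size (mset_vec gs v) = sumn v.
Proof.
rewrite size_seq_mset; elim: gs v => [|g gs IH] [|n v] //= [/IH E].
by rewrite size_cat size_nseq E.
Qed.

Lemma mset_vec_eq0 gs v : size v = size gs -> (mset_vec gs v == mset0) = vzero v.
Proof.
move=> sv; rewrite -size_mset_eq0 size_mset_vec // /vzero.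
by elim: v {sv} => //= n v <-; rewrite addn_eq0.
Qed.

Lemma mset_vec_nseq0 gs : mset_vec gs (nseq (size gs) 0) = mset0.
Proof.
by apply/eqP; rewrite mset_vec_eq0 ?size_nseq // /vzero all_nseq /= orbT.
Qed.

Lemma mset_vec_add gs v w : size v = size gs -> size w = size gs ->
  mset_vec gs (vadd v w) = mset_vec gs v `+` mset_vec gs w.
Proof.
elim: gs v w => [|g gs IH] [|n v] [|m w] //=.
  by move=> _ _; apply/msetP => x; rewrite msetE2 !mset_seqE.
move=> [sv] [sw]; rewrite !mset_vec_cons IH //; apply/msetP => x.
by rewrite !msetE2 !msetnE; case: eqP => _; lia.
Qed.

Lemma mset_vec_sub gs v w : size v = size gs -> w \in subvecs v ->
  mset_vec gs v = mset_vec gs w `+` mset_vec gs (vsub v w).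
Proof.
elim: gs v w => [|g gs IH] [|n v] w //.
  by move=> _ _; apply/msetP => x; rewrite msetE2 !mset_seqE.
move=> [sv] /subvecsP [i [w' [-> le_in w'v]]] /=.
rewrite !mset_vec_cons (IH v w') //; apply/msetP => x.
by rewrite !msetE2 !msetnE; case: eqP => _; lia.
Qed.

Lemma mset_vec_split gs v T U : size v = size gs -> mset_vec gs v = T `+` U ->
  exists2 w, w \in subvecs v & T = mset_vec gs w /\ U = mset_vec gs (vsub v w).
Proof.
elim: gs v T U => [|g gs IH] [|n v] T U //= sv.
  move=> E; have E0 x : T x + U x = 0.
    by have := congr1 (fun B : {mset gT} => B x) E; rewrite msetE2 mset_seqE.
  exists [::]; rewrite ?inE //; split; apply/msetP => x; rewrite mset_seqE /=;
    by have /eqP := E0 x; rewrite addn_eq0 => /andP [/eqP ? /eqP ?].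
rewrite mset_vec_cons => E.
have Ex x : (if x == g then n else 0) + mset_vec gs v x = T x + U x.
  by have := congr1 (fun B : {mset gT} => B x) E; rewrite !msetE2 msetnE.
set i := minn (T g) n.
have [||w wv [T'E U'E]] := IH v (T `\` msetn i g) (U `\` msetn (n - i) g).
- by case: sv.
- apply/msetP => x; have := Ex x; rewrite !msetE2 !msetnE /i.
  by case: eqP => [->|_]; lia.
exists (i :: w).
  by apply: mem_subvecs => //; exact: geq_minr.
rewrite !mset_vec_cons -T'E -U'E; split; apply/msetP => x; have := Ex x;
  rewrite !msetE2 !msetnE /i; case: eqP => [->|_]; lia.
Qed.

Section Support.

Variables (gs : seq gT) (po : seq nat -> bool).
Hypothesis poP : forall v, size v = size gs -> product_one (mset_vec gs v) <-> po v.

(** Nested [if] in place of boolean connectives, because call-by-value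
    evaluation computes both arguments of a connective. *)
Definition atomv v : bool :=
  if vzero v then false else if po v then
    all (fun w => if vzero w then true else if po w then
      let u := vsub v w in if vzero u then true else ~~ po u else true)
      (subvecs v)
  else false.

Lemma atomvP v : size v = size gs -> atoms (mset_vec gs v) <-> atomv v.
Proof.
move=> sv; rewrite /atomv -(mset_vec_eq0 sv); split=> [atv|].
  rewrite (negPf (atoms_neq0 atv)) ((poP sv).1 (atoms_product_one atv)).
  apply/allP => w wv; have sw := size_subvec wv; have su := size_vsub_sub wv.
  rewrite sv in sw su; have E := mset_vec_sub sv wv.
  rewrite -(mset_vec_eq0 sw) -(mset_vec_eq0 su); case: ifPn => // w0.
  case: ifPn => // pow; case: ifPn => // u0; apply/negP => pou.
  by case: atv => _ _; apply; exists (mset_vec gs w), (mset_vec gs (vsub v w)); split=> //;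
    apply/poP.
case: ifPn => // v0; case: ifPn => // pov /allP atv; split=> //; first exact/poP.
move=> [T [U [poT poU T0 U0 E]]].
have [w wv [TE UE]] := mset_vec_split sv E; have := atv w wv.
have sw := size_subvec wv; have su := size_vsub_sub wv; rewrite sv in sw su.
rewrite -(mset_vec_eq0 sw) -(mset_vec_eq0 su) -TE -UE (negPf T0) (negPf U0).
by rewrite (poP sw).1 -?TE // (poP su).1 -?UE.
Qed.

Lemma factorizations_vec vs : all (fun v => (size v == size gs) && atomv v) vs ->
  exists z, [/\ factorizations (mset_vec gs (vsum (size gs) vs)) z, size z = size vs
    & size (vsum (size gs) vs) = size gs].
Proof.
elim: vs => [|v vs IH] /=.
  exists mset0; rewrite mset_vec_nseq0 size_nseq size_mset0; split=> //.
  exact: factorizations0.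
move=> /andP [/andP [/eqP sv atv] /IH [z [fz sz sE]]].
exists (mset_vec gs v +` z); split.
- by rewrite mset_vec_add //; apply: factorizations_cons => //; exact/atomvP.
- by rewrite size_mset_cons sz.
- by rewrite size_vadd // sE.
Qed.

(** A factorization into three atoms is searched with a longest atom last. The
    resulting size bounds on the first two atoms keep the number of orderings
    to be tried small. *)
Definition no_length3 v : bool :=
  all (fun a => if (sumn a).*2 <= sumn v then if atomv a then
    let r := vsub v a in
    all (fun b => if (sumn b).*2 <= sumn r then if atomv b then ~~ atomv (vsub r b)
      else true else true) (subvecs r) else true else true) (subvecs v).

Lemma no_length3P v : size v = size gs -> no_length3 v -> ~ lengths (mset_vec gs v) 3.
Proof.
move=> sv nv L3.
have H A B C : atoms A -> atoms B -> atoms C -> mset_vec gs v = A `+` (B `+` C) ->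
    size A <= size C -> size B <= size C -> False.
  move=> atA atB atC E leAC leBC.
  have [a av [AE RE]] := mset_vec_split sv E.
  have sa := size_subvec av; have sr := size_vsub_sub av; rewrite sv in sa sr.
  have [b br [BE CE]] := mset_vec_split sr (esym RE).
  have sb := size_subvec br; have sc := size_vsub_sub br; rewrite sr in sb sc.
  have sumv : sumn v = size A + (size B + size C).
    by rewrite -(size_mset_vec sv) E !size_msetD.
  have sumr : sumn (vsub v a) = size B + size C.
    by rewrite -(size_mset_vec sr) -RE size_msetD.
  have suma : sumn a = size A by rewrite -(size_mset_vec sa) -AE.
  have sumb : sumn b = size B by rewrite -(size_mset_vec sb) -BE.
  move: nv => /allP /(_ a av) /=; rewrite suma sumv ifT; last by lia.
  rewrite ifT; last by apply/atomvP; rewrite // -AE.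
  move=> /allP /(_ b br) /=; rewrite sumb sumr ifT; last by lia.
  rewrite ifT; last by apply/atomvP; rewrite // -BE.
  by move=> /negP; apply; apply/atomvP; rewrite // -CE.
move: L3 => /(lengthsP _ 3) [z fz sz].
have pick S (w : {mset {mset gT}}) n : factorizations S w -> size w = n.+1 ->
    exists A T u, [/\ atoms A, S = A `+` T, factorizations T u & size u = n].
  move=> fw sw; have [w0|[A Aw]] := mset0_or_mem w; first by rewrite w0 size_mset0 in sw.
  have [T [u [wE SE fu]]] := factorizations_split fw Aw.
  exists A, T, u; split=> //; first by case: fw => + _; apply.
  by move: sw; rewrite wE size_mset_cons => -[].
have [A [T [w [atA vE fw sw]]]] := pick _ _ _ fz sz.
have [B [U [x [atB TE fx sx]]]] := pick _ _ _ fw sw.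
have [C [V [y [atC UE fy sy]]]] := pick _ _ _ fx sx.
have V0 : V = mset0 by case: fy => _ <-; rewrite (mset_size0 sy) big_mset0.
rewrite TE UE V0 msetD0 in vE.
have vE' : mset_vec gs v = C `+` (B `+` A).
  by rewrite vE (msetDC B C) msetDA (msetDC (A `+` C)) (msetDC A C) msetDCA.
have vE'' : mset_vec gs v = A `+` (C `+` B) by rewrite vE (msetDC B C).
have [leAC|ltCA] := leqP (size A) (size C); have [leBC|ltCB] := leqP (size B) (size C).
- exact: (H A B C).
- by apply: (H A C B) => //; lia.
- by apply: (H C B A) => //; lia.
have [leAB|ltBA] := leqP (size A) (size B).
- by apply: (H A C B) => //; lia.
- by apply: (H C B A) => //; lia.
Qed.

(** A certificate that 2 and another number are lengths of the same sequence. *)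
Definition relates n us ws : bool :=
  if all (fun v => (size v == n) && atomv v) us then
  if all (fun v => (size v == n) && atomv v) ws then
  [&& size us == 2, size ws != 2 & vsum n us == vsum n ws] else false else false.

Lemma relatesP us ws : relates (size gs) us ws ->
  [/\ size (vsum (size gs) us) = size gs, size ws <> 2,
    lengths (mset_vec gs (vsum (size gs) us)) 2
    & lengths (mset_vec gs (vsum (size gs) us)) (size ws)%:Z].
Proof.
rewrite /relates; case: ifPn => // /factorizations_vec [z [fz sz sE]].
case: ifPn => // /factorizations_vec [w [fw sw _]].
move=> /and3P [/eqP us2 ws2 /eqP E]; split=> //; first exact/eqP.
- by apply/(lengthsP _ 2); exists z; rewrite ?sz.
- by apply/lengthsP; exists w; rewrite // E.
Qed.

Lemma has_relation_vec us ws : relates (size gs) us ws ->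
  has_relation (mset_vec gs (vsum (size gs) us)).
Proof. by move=> /relatesP [_ ws2 L2 Ln]; split=> //; exists (size ws). Qed.

Definition refutes3 n us ws : bool :=
  if relates n us ws then no_length3 (vsum n us) else false.

Lemma refutes3P us ws : refutes3 (size gs) us ws -> ~ reaches3 gT.
Proof.
rewrite /refutes3; case: ifPn => // /relatesP [sE ws2 L2 Ln] no3 r3.
exact: (no_length3P sE no3) (r3 _ _ L2 Ln ws2).
Qed.

End Support.

End Vectors.

Notation expo3 := (nat * nat * nat)%type.

(* In all groups considered below the relevant elements have a normal form
   a^i b^j c^k. The product of such elements and the test for the identity are
   carried out on the exponents, which makes product-one sequences decidable by
   evaluation. *)
Section Codes.

Variable gT : finGroupType.
Variables (phi : expo3 -> gT) (mul : expo3 -> expo3 -> expo3) (isone : expo3 -> bool).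
Hypothesis phi1 : phi (0, 0, 0) = 1%g.
Hypothesis phiM : forall x y, phi (mul x y) = (phi x * phi y)%g.
Hypothesis phiK : forall x, phi x = 1%g <-> isone x.

Definition eval (s : seq expo3) : expo3 := foldr mul (0, 0, 0) s.

Lemma evalE s : (\prod_(x <- map phi s) x)%g = phi (eval s).
Proof.
by elim: s => [|x s IH] /=; rewrite ?big_nil ?phi1 // big_cons IH phiM.
Qed.

Definition po_perm (cs : seq expo3) v : bool :=
  has (fun s => isone (eval s)) (permutations (expand cs v)).

Lemma po_permP cs v : product_one (mset_vec (map phi cs) v) <-> po_perm cs v.
Proof.
rewrite /mset_vec map_expand; split=> [[s]|/hasP [s]].
  move=> /perm_trans /(_ (perm_eq_seq_mset _)) /(perm_iotaP 1%g) [I pI ->].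
  rewrite size_map in pI.
  pose t := [seq nth (0, 0, 0) (expand cs v) i | i <- I].
  have -> : [seq nth 1%g [seq phi i | i <- expand cs v] i | i <- I] = map phi t.
    rewrite -map_comp; apply/eq_in_map => i; rewrite (perm_mem pI) mem_iota => /andP [_ lti].
    by rewrite (nth_map (0, 0, 0)).
  rewrite evalE => /phiK one; apply/hasP; exists t => //.
  by rewrite mem_permutations; apply/(perm_iotaP (0, 0, 0)); exists I.
rewrite mem_permutations => ps /phiK one.
exists (map phi s); last by rewrite evalE.
by rewrite perm_sym (perm_trans (perm_eq_seq_mset _)) // perm_map // perm_sym.
Qed.

Lemma not_reaches3_perm cs us ws :
  refutes3 (po_perm cs) (size cs) us ws -> ~ reaches3 gT.
Proof.
move=> ref; apply: (@refutes3P _ (map phi cs) (po_perm cs) _ us ws).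
  by move=> v _; exact: po_permP.
by rewrite size_map.
Qed.

Definition po_abel (cs : seq expo3) v : bool := isone (eval (expand cs v)).

Lemma po_abelP cs v : (forall x y : gT, commute x y) ->
  product_one (mset_vec (map phi cs) v) <-> po_abel cs v.
Proof.
move=> abelG; have ps : perm_eq (map phi (expand cs v)) (mset_vec (map phi cs) v).
  by rewrite -map_expand perm_sym perm_eq_seq_mset.
rewrite /po_abel -phiK -evalE; exact: product_one_abelP ps.
Qed.

Lemma not_reaches3_abel cs us ws : (forall x y : gT, commute x y) ->
  refutes3 (po_abel cs) (size cs) us ws -> ~ reaches3 gT.
Proof.
move=> abelG ref; apply: (@refutes3P _ (map phi cs) (po_abel cs) _ us ws).
  by move=> v _; exact: po_abelP.
by rewrite size_map.
Qed.

End Codes.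

(** * Groups with a sequence of lengths 2 and 4 but not 3 *)

Section Models.

Variable gT : finGroupType.
Implicit Types (a b c g r s t u : gT).
Local Open Scope group_scope.

Definition monomial a b c (x : expo3) : gT := a ^+ x.1.1 * b ^+ x.1.2 * c ^+ x.2.

Lemma monomial1 a b c : monomial a b c (0, 0, 0) = 1.
Proof. by rewrite /monomial !expg0 !mulg1. Qed.

Lemma expg_prime_eq1 p a i : prime p -> a ^+ p = 1 -> a != 1 ->
  (a ^+ i == 1) = (p %| i)%N.
Proof. by move=> pr ap a1; rewrite -order_dvdn (nt_prime_order pr ap a1). Qed.

(** If p does not divide i, then a is a power of a^i. *)
Lemma expg_cancel_prime (H : {group gT}) p a i : prime p -> a ^+ p = 1 ->
  a ^+ i \in H -> a \notin H -> (p %| i)%N.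
Proof.
move=> pr ap aiH; apply: contraNT => npi.
have co : coprime #|<[a]>| i.
  apply: (@coprime_dvdl _ p); first by rewrite -orderE order_dvdn ap.
  by rewrite prime_coprime.
by rewrite -(expgK co (cycle_id a)) groupX.
Qed.

Lemma expg_dvd p a i : a ^+ p = 1 -> (p %| i)%N -> a ^+ i = 1.
Proof. by move=> ap /dvdnP [m ->]; rewrite mulnC expgM ap expg1n. Qed.

Definition one_mod p (x : expo3) := [&& p %| x.1.1, p %| x.1.2 & p %| x.2].

Lemma monomial_one_mod p a b c x : a ^+ p = 1 -> b ^+ p = 1 -> c ^+ p = 1 ->
  one_mod p x -> monomial a b c x = 1.
Proof.
move=> ap bp cp; case: x => [[i j] k] /and3P /= [pi pj pk]; rewrite /monomial /=.
by rewrite (expg_dvd ap) // (expg_dvd bp) // (expg_dvd cp) // !mulg1.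
Qed.

Definition mul_S3 (x y : expo3) : expo3 :=
  ((x.1.1 + (if odd x.1.2 then y.1.1.*2 else y.1.1)) %% 3, x.1.2 + y.1.2, 0).

Definition one_S3 (x : expo3) := (3 %| x.1.1) && ~~ odd x.1.2.

(** The sequence has four terms s and two terms each of r and r^2. As
    s r s r = 1, two terms s and two terms r form an atom, and so do two terms s
    and two terms r^2. The other factorization has two atoms s^2 and two atoms
    consisting of r and r^2. *)
Lemma not_reaches3_S3 r s : r ^+ 3 = 1 -> s ^+ 2 = 1 -> s * r = r ^+ 2 * s ->
  r != 1 -> s != 1 -> ~ reaches3 gT.
Proof.
move=> r3 s2 sr r1 s1; set f := monomial r s 1.
have fM x y : f (mul_S3 x y) = f x * f y.
  case: x y => [[i j] k] [[i' j'] k']; rewrite /f /monomial /= !expg1n !mulg1 expg_mod //.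
  rewrite expgD -!mulgA; congr mulg; rewrite expgD !mulgA; congr mulg.
  have sri n : s * r ^+ n = r ^+ n.*2 * s.
    elim: n => [|n IH]; first by rewrite mulg1 mul1g.
    by rewrite doubleS expgS mulgA sr -mulgA IH mulgA -expgD.
  have s2i n : s ^+ n.*2 = 1 by rewrite -mul2n expgM s2 expg1n.
  rewrite -[j in RHS]odd_double_half -[j in LHS]odd_double_half.
  by rewrite oddD odd_double addbF; case: (odd j); rewrite /= !expgD !s2i !mulg1 ?mul1g ?sri.
have fK x : f x = 1 <-> one_S3 x.
  case: x => [[i j] k]; rewrite /f /monomial /one_S3 /= expg1n mulg1.
  rewrite -(expg_prime_eq1 i _ r3) // -dvdn2 -(expg_prime_eq1 j _ s2) //; split; last first.
    by move=> /andP [/eqP -> /eqP ->]; rewrite mulg1.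
  move=> rs1; have sE : s ^+ j = (r ^+ i)^-1 by apply: (mulgI (r ^+ i)); rewrite rs1 mulgV.
  have : s ^+ (j * 3) == 1.
    by rewrite expgM sE expgVn -expgM mulnC expgM r3 expg1n invg1.
  rewrite (expg_prime_eq1 _ _ s2) // Euclid_dvdM // orbF -(expg_prime_eq1 j _ s2) // => /eqP sj.
  by move: rs1; rewrite sj mulg1 => ->; rewrite eqxx.
by apply: (@not_reaches3_perm _ f mul_S3 one_S3 (monomial1 _ _ _) fM fK
  [:: (0,1,0); (1,0,0); (2,0,0)]
  [:: [:: 2;2;0]; [:: 2;0;2]] [:: [:: 2;0;0]; [:: 2;0;0]; [:: 0;1;1]; [:: 0;1;1]])%N; vm_compute.
Qed.

(** Conjugation by g permutes t, u and tu cyclically, so it sends t^i u^j to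
    t^j u^(i+j). *)
Definition act_A4 k (x : nat * nat) := iter (k %% 3) (fun x => (x.2, (x.1 + x.2) %% 2)%N) x.

Definition mul_A4 (x y : expo3) : expo3 :=
  let z := act_A4 x.2 y.1 in ((x.1.1 + z.1, x.1.2 + z.2), x.2 + y.2)%N.

Definition one_A4 (x : expo3) := [&& 2 %| x.1.1, 2 %| x.1.2 & 3 %| x.2].

(** The sequence consists of t, u, g and g^-1, each taken twice. It is the square
    of the atom t u g g^-1, and the product of the four atoms t^2, u^2 and twice
    g g^-1. *)
Lemma not_reaches3_A4 t u g : t ^+ 2 = 1 -> u ^+ 2 = 1 -> g ^+ 3 = 1 -> commute t u ->
  g * t = u * g -> g * u = t * u * g -> t != 1 -> u != 1 -> t != u -> g != 1 ->
  ~ reaches3 gT.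
Proof.
move=> t2 u2 g3 tu gt gu t1 u1 ntu g1; set f := monomial t u g.
have fM x y : f (mul_A4 x y) = f x * f y.
  case: x y => [[i j] k] [[i' j'] k']; rewrite /f /monomial /mul_A4 /=.
  have gkE n i1 j1 : let z := iter n (fun x => (x.2, (x.1 + x.2) %% 2)%N) (i1, j1) in
      g ^+ n * (t ^+ i1 * u ^+ j1) = t ^+ z.1 * u ^+ z.2 * g ^+ n.
    elim: n => [|n IH] /=; first by rewrite mul1g mulg1.
    rewrite expgS -mulgA IH; case: (iter _ _ _) => i2 j2 /=.
    have gtn m : g * t ^+ m = u ^+ m * g.
      by elim: m => [|m IHm]; rewrite ?mulg1 ?mul1g // !expgS mulgA gt -mulgA IHm mulgA.
    have gun m : g * u ^+ m = t ^+ m * u ^+ m * g.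
      rewrite -expgMn //; elim: m => [|m IHm]; first by rewrite mulg1 mul1g.
      by rewrite !expgS mulgA gu -mulgA IHm mulgA.
    rewrite !mulgA gtn -(mulgA _ g) gun expg_mod // expgD !mulgA.
    do 3 congr (_ * _); exact: commuteX2 (commute_sym tu).
  have := gkE (k %% 3)%N i' j'; rewrite /act_A4 expg_mod //.
  case: (iter _ _ _) => i2 j2 /= gkz.
  have -> : t ^+ i * u ^+ j * g ^+ k * (t ^+ i' * u ^+ j' * g ^+ k') =
            t ^+ i * u ^+ j * (g ^+ k * (t ^+ i' * u ^+ j')) * g ^+ k' by rewrite !mulgA.
  rewrite gkz !expgD !mulgA; do 3 congr (_ * _).
  by rewrite -!(mulgA (t ^+ i)); congr mulg; exact: commuteX2.
have tuK i j : t ^+ i * u ^+ j = 1 -> (2 %| i) && (2 %| j).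
  rewrite -(expg_mod i t2) -(expg_mod j u2) !modn2 !dvdn2.
  case: (odd i); case: (odd j) => //=; rewrite ?expg0 ?expg1 ?mulg1 ?mul1g => E.
  - by case/eqP: ntu; apply: (mulIg u); rewrite E -u2 expgS expg1.
  - by rewrite E eqxx in t1.
  - by rewrite E eqxx in u1.
have fK x : f x = 1 <-> one_A4 x.
  case: x => [[i j] k]; rewrite /f /monomial /one_A4 /=; split; last first.
    move=> /and3P [i2 j2 k3].
    by rewrite (expg_dvd t2) // (expg_dvd u2) // (expg_dvd g3) // !mulg1.
  move=> tug; have gk : g ^+ k = (t ^+ i * u ^+ j)^-1.
    by apply: (mulgI (t ^+ i * u ^+ j)); rewrite tug mulgV.
  have : g ^+ (k * 2) == 1.
    rewrite expgM gk expgVn expgMn; last exact: commuteX2.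
    by rewrite -!expgM ![(_ * 2)%N]mulnC !expgM t2 u2 !expg1n mulg1 invg1.
  rewrite (expg_prime_eq1 _ _ g3) // Euclid_dvdM // orbF => k3; rewrite k3 andbT.
  by apply: tuK; move: tug; rewrite (expg_dvd g3) // mulg1.
by apply: (@not_reaches3_perm _ f mul_A4 one_A4 (monomial1 _ _ _) fM fK
  [:: (1,0,0); (0,1,0); (0,0,1); (0,0,2)]
  [:: [:: 1;1;1;1]; [:: 1;1;1;1]]
  [:: [:: 0;0;1;1]; [:: 0;0;1;1]; [:: 0;2;0;0]; [:: 2;0;0;0]])%N; vm_compute.
Qed.

(** In the Heisenberg group b^j a^i = a^i b^j c^(ij), with c the commutator. *)
Definition mul_heis (x y : expo3) : expo3 :=
  (x.1.1 + y.1.1, x.1.2 + y.1.2, x.2 + y.2 + x.1.2 * y.1.1)%N.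

(** The sequence consists of a, a^2, three times the conjugate ac of a, and
    twice b and b^2. It is the product of the atoms a^2 (ac) b b^2 and
    a (ac)^2 b b^2, where a^2 and b^2 are single terms, and also
    of (a a^2), (ac)^3 and two copies of (b b^2). *)
Lemma not_reaches3_heisenberg a b c : a ^+ 3 = 1 -> b ^+ 3 = 1 -> c ^+ 3 = 1 ->
  b * a = a * b * c -> commute c a -> commute c b -> c != 1 -> ~ reaches3 gT.
Proof.
move=> a3 b3 c3 ba ca cb c1; set f := monomial a b c.
have fM x y : f (mul_heis x y) = f x * f y.
  case: x y => [[i j] k] [[i' j'] k']; rewrite /f /monomial /mul_heis /=.
  have ban n : b * a ^+ n = a ^+ n * b * c ^+ n.
    elim: n => [|n IH]; first by rewrite !mulg1 mul1g.
    rewrite expgS mulgA ba -!mulgA; congr mulg.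
    by rewrite (commuteX n ca) !mulgA IH expgSr mulgA.
  have bman m n : b ^+ m * a ^+ n = a ^+ n * b ^+ m * c ^+ (m * n).
    elim: m => [|m IH]; first by rewrite !mulg1 mul1g.
    rewrite expgS -mulgA IH !mulgA ban -(mulgA _ (c ^+ n)) (commuteX2 _ _ cb).
    by rewrite mulSn expgD !mulgA.
  rewrite !expgD !mulgA.
  rewrite -(mulgA _ (c ^+ k) (a ^+ i')) (commuteX2 k i' ca) !mulgA.
  rewrite -(mulgA _ (c ^+ k) (b ^+ j')) (commuteX2 k j' cb) !mulgA.
  rewrite -(mulgA _ (b ^+ j) (a ^+ i')) bman !mulgA.
  rewrite -(mulgA _ (c ^+ (j * i')) (b ^+ j')) (commuteX2 (j * i') j' cb) !mulgA.
  by rewrite -!(mulgA _ (c ^+ _)) -!expgD; congr (_ * c ^+ _); lia.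
have nab : b \notin 'C[a].
  apply: contraNN c1 => /cent1P /commute_sym E; apply/eqP/(mulgI (a * b)).
  by rewrite mulg1 -ba.
have nba : a \notin 'C[b] by rewrite cent1C.
have fK x : f x = 1 <-> one_mod 3 x.
  split; last exact: monomial_one_mod.
  case: x => [[i j] k]; rewrite /f /monomial /one_mod /= => abc.
  have j3 : (3 %| j)%N.
    apply: (@expg_cancel_prime 'C[a] _ b) => //.
    have -> : b ^+ j = (a ^+ i)^-1 * (c ^+ k)^-1.
      by apply: (mulgI (a ^+ i)); apply: (mulIg (c ^+ k)); rewrite abc mulKVg mulVg.
    by rewrite groupM ?groupV ?groupX ?cent1id //; apply/cent1P/commute_sym.
  rewrite (expg_dvd b3 j3) mulg1 in abc.
  have i3 : (3 %| i)%N.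
    apply: (@expg_cancel_prime 'C[b] _ a) => //.
    have -> : a ^+ i = (c ^+ k)^-1 by apply: (mulIg (c ^+ k)); rewrite abc mulVg.
    by rewrite groupV groupX //; apply/cent1P/commute_sym.
  rewrite (expg_dvd a3 i3) mul1g in abc.
  by rewrite i3 j3 -(expg_prime_eq1 k _ c3) // abc eqxx.
by apply: (@not_reaches3_perm _ f mul_heis (one_mod 3) (monomial1 _ _ _) fM fK
  [:: (1,0,0); (2,0,0); (1,0,1); (0,1,0); (0,2,0)]
  [:: [:: 0;1;1;1;1]; [:: 1;0;2;1;1]]
  [:: [:: 0;0;0;1;1]; [:: 0;0;0;1;1]; [:: 0;0;3;0;0]; [:: 1;1;0;0;0]])%N; vm_compute.
Qed.

Definition mul_add (x y : expo3) : expo3 :=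
  (x.1.1 + y.1.1, x.1.2 + y.1.2, x.2 + y.2)%N.

Lemma monomial_add a b c x y : commute a b -> commute a c -> commute b c ->
  monomial a b c (mul_add x y) = monomial a b c x * monomial a b c y.
Proof.
move=> ab ac bc; case: x y => [[i j] k] [[i' j'] k']; rewrite /monomial /=.
rewrite !expgD !mulgA -(mulgA _ (c ^+ k) (a ^+ i')) -(commuteX2 i' k ac) !mulgA.
rewrite -(mulgA _ (c ^+ k) (b ^+ j')) -(commuteX2 j' k bc) !mulgA.
by rewrite -(mulgA _ (b ^+ j) (a ^+ i')) -(commuteX2 i' j ab) !mulgA.
Qed.

Lemma monomial_free p a b c x : prime p -> a ^+ p = 1 -> b ^+ p = 1 -> c ^+ p = 1 ->
  a != 1 -> b \notin <[a]> -> c \notin <<[set a; b]>> ->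
  monomial a b c x = 1 <-> one_mod p x.
Proof.
move=> pr ap bp cp a1 ba cab; split; last exact: monomial_one_mod.
case: x => [[i j] k]; rewrite /monomial /one_mod /= => abc.
have kp : (p %| k)%N.
  apply: (@expg_cancel_prime <<[set a; b]>> _ c) => //.
  have -> : c ^+ k = (a ^+ i * b ^+ j)^-1.
    by apply: (mulgI (a ^+ i * b ^+ j)); rewrite abc mulgV.
  by rewrite groupV groupM // groupX // mem_gen // !inE eqxx ?orbT.
rewrite (expg_dvd cp kp) mulg1 in abc.
have jp : (p %| j)%N.
  apply: (@expg_cancel_prime <[a]> _ b) => //.
  have -> : b ^+ j = (a ^+ i)^-1 by apply: (mulgI (a ^+ i)); rewrite abc mulgV.
  by rewrite groupV mem_cycle.
rewrite (expg_dvd bp jp) mulg1 in abc.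
by rewrite kp jp -(expg_prime_eq1 i pr ap) // abc eqxx.
Qed.

(** For p = 2 the sequence is (a b c abc)^2. For p = 3 it is (a b c d)^3 with
    d = a^2 b^2 c, the product of the atoms a b c^2 d and a^2 b^2 c d^2. *)
Lemma not_reaches3_rank3 p a b c : (forall x y : gT, commute x y) -> p \in [:: 2; 3] ->
  (forall x : gT, x ^+ p = 1) ->
  a != 1 -> b \notin <[a]> -> c \notin <<[set a; b]>> -> ~ reaches3 gT.
Proof.
move=> abelG p23 expG a1 ba cab.
have pr : prime p by move: p23; rewrite !inE => /orP [] /eqP ->.
have fM x y := monomial_add x y (abelG a b) (abelG a c) (abelG b c).
have fK x := monomial_free x pr (expG a) (expG b) (expG c) a1 ba cab.
move: p23 fK; rewrite !inE => /orP [] /eqP -> fK.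
  by apply: (@not_reaches3_abel _ _ _ _ (monomial1 _ _ _) fM fK
    [:: (1,0,0); (0,1,0); (0,0,1); (1,1,1)]
    [:: [:: 1;1;1;1]; [:: 1;1;1;1]]
    [:: [:: 2;0;0;0]; [:: 0;2;0;0]; [:: 0;0;2;0]; [:: 0;0;0;2]] abelG)%N; vm_compute.
by apply: (@not_reaches3_abel _ _ _ _ (monomial1 _ _ _) fM fK
  [:: (1,0,0); (0,1,0); (0,0,1); (2,2,1)]
  [:: [:: 1;1;2;1]; [:: 2;2;1;2]]
  [:: [:: 3;0;0;0]; [:: 0;3;0;0]; [:: 0;0;3;0]; [:: 0;0;0;3]] abelG)%N; vm_compute.
Qed.

End Models.

(** * Sequences of powers of an element and its inverse *)

Section Cyclic.

Variable gT : finGroupType.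
Implicit Types (g h x : gT) (A B S T U : {mset gT}) (z : {mset {mset gT}}).

Lemma prod_inv_pair g (s : seq gT) : g != g^-1%g -> all (pred2 g g^-1%g) s ->
  (\prod_(x <- s) x)%g = (g ^+ count_mem g s * g^-1 ^+ count_mem g^-1 s)%g.
Proof.
move=> gh; elim: s => [_|x s IH /= /andP [/orP [] /eqP -> /IH E]].
- by rewrite big_nil mulg1.
- by rewrite big_cons E eqxx (negPf gh) add1n add0n expgS mulgA.
- rewrite big_cons E eqxx eq_sym (negPf gh) add1n add0n expgS !mulgA.
  by congr mulg; apply: (@commuteX _ g^-1%g g); exact/commute_sym/commuteV.
Qed.

Lemma product_one_pair g T : g != g^-1%g -> (forall x, x \in T -> x = g \/ x = g^-1%g) ->
  product_one T -> (g ^+ T g = g ^+ T g^-1)%g.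
Proof.
move=> gh Tgh [s sT]; rewrite (prod_inv_pair gh); last first.
  apply/allP => x; rewrite (perm_mem sT) => /Tgh [] ->; rewrite /= eqxx ?orbT //.
rewrite !(seq.permP sT) !count_mem_mset expVgn => /eqP; rewrite -eq_mulgV1.
by move/eqP.
Qed.

Definition pair_mset g i j : {mset gT} := msetn i g `+` msetn j g^-1%g.

Lemma pair_msetE g i j x : g != g^-1%g ->
  pair_mset g i j x = (if x == g then i else if x == g^-1%g then j else 0).
Proof.
move=> gh; rewrite msetE2 !msetnE; case: eqP => [->|_]; last by case: eqP.
by rewrite (negPf gh) addn0.
Qed.

Lemma pair_mset_sub g i j T : g != g^-1%g -> T `<=` pair_mset g i j ->
  [/\ T = pair_mset g (T g) (T g^-1%g), T g <= i & T g^-1%g <= j].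
Proof.
move=> gh /msubsetP sT; split; last 2 first.
- by have := sT g; rewrite pair_msetE // eqxx.
- by have := sT g^-1%g; rewrite pair_msetE // eq_sym (negPf gh) eqxx.
apply/msetP => x; rewrite pair_msetE //; case: eqP => [->//|/eqP xg].
case: eqP => [->//|/eqP xh]; have := sT x; rewrite pair_msetE //.
by rewrite (negPf xg) (negPf xh); lia.
Qed.

Lemma product_one_pairP g i j : g != g^-1%g ->
  product_one (pair_mset g i j) <-> (g ^+ i = g ^+ j)%g.
Proof.
move=> gh; split=> [po|E].
  have := product_one_pair gh _ po; rewrite !pair_msetE // !eqxx eq_sym (negPf gh).
  by apply=> x; rewrite in_mset pair_msetE //; case: eqP; [left|case: eqP; [right|]].
rewrite /pair_mset -!seq_mset_nseq -seq_mset_cat; apply: product_one_seq.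
rewrite (prod_inv_pair gh); last by rewrite all_cat !all_nseq /= !eqxx !orbT.
rewrite !count_cat !count_nseq /= !eqxx eq_sym (negPf gh) !mul1n !mul0n addn0 add0n.
by rewrite E expVgn mulgV.
Qed.

Lemma expg_eq_le g i j : i <= #[g] -> j <= #[g] -> (g ^+ i = g ^+ j)%g ->
  [\/ i = j, i = 0 /\ j = #[g] | i = #[g] /\ j = 0].
Proof.
move=> lei lej /eqP; rewrite eq_expg_mod_order.
have [->|nei] := eqVneq i #[g].
  have [->|nej] := eqVneq j #[g]; first by constructor 1.
  by rewrite modnn modn_small ?ltn_neqAle ?nej // => /eqP; constructor 3.
have [->|nej] := eqVneq j #[g].
  by rewrite modnn modn_small ?ltn_neqAle ?nei // => /eqP; constructor 2.
by rewrite !modn_small ?ltn_neqAle ?nei ?nej // => /eqP; constructor 1.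
Qed.

Section Order.

Variable g : gT.
Let n := #[g].
Hypothesis n3 : 2 < n.

Lemma neq_invg : g != g^-1%g.
Proof.
apply/negP => /eqP E; have : (g ^+ 2 == 1)%g by rewrite expgS expg1 {1}E mulVg.
by rewrite -order_dvdn => /dvdn_leq; rewrite -/n; lia.
Qed.
Let gh := neq_invg.

Lemma pair_mset_eq0 i j : (pair_mset g i j == mset0) = (i + j == 0).
Proof. by rewrite -size_mset_eq0 size_msetD !enum_msetn !size_nseq. Qed.

(** A sequence with i terms g and j terms g^-1 is product-one if and only if
    g^i = g^j. If both terms occur in an atom, then g g^-1 is all of it. *)
Lemma atoms_pair_sub A i j : i <= n -> j <= n -> A `<=` pair_mset g i j -> atoms A ->
  [\/ A = pair_mset g 1 1, A = pair_mset g n 0 | A = pair_mset g 0 n].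
Proof.
move=> lei lej /pair_mset_sub [] // AE leA leA' atA.
move: AE leA leA'; set i' := A g; set j' := A g^-1%g => AE leA leA'.
have := atoms_product_one atA; rewrite AE => /(product_one_pairP _ _ gh) E.
have [||E'|[-> ->]|[-> ->]] := @expg_eq_le g i' j' _ _ E; rewrite -/n;
  [lia|lia| |by constructor 3|by constructor 2].
have i0 : 0 < i'.
  by have := atoms_neq0 atA; rewrite AE pair_mset_eq0 -E'; lia.
have AE' : A = pair_mset g 1 1 `+` pair_mset g i'.-1 i'.-1.
  by rewrite AE -E'; apply/msetP => x; rewrite msetE2 !pair_msetE //; case: eqP => _; [|case: eqP => _]; lia.
have [||E0|E0] := atom_dvd atA _ _ AE'; [exact/product_one_pairP|exact/product_one_pairP| |].
- by move/eqP: E0; rewrite pair_mset_eq0.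
- by constructor 1; rewrite -AE AE' E0 msetD0.
Qed.

Lemma atoms_pair i j : (i, j) \in [:: (1, 1); (n, 0); (0, n)] -> atoms (pair_mset g i j).
Proof.
move=> ij; have poij : product_one (pair_mset g i j).
  apply/product_one_pairP => //.
  by move: ij; rewrite !inE => /or3P [] /eqP [-> ->]; rewrite ?expg_order.
have ij0 : 0 < i + j by move: ij; rewrite !inE => /or3P [] /eqP [-> ->]; lia.
have [z fz] := factorizations_exist poij.
have [z0|[A Az]] := mset0_or_mem z.
  by case: fz => _; rewrite z0 big_mset0 => /esym/eqP; rewrite pair_mset_eq0; lia.
have [T [w [_ E _]]] := factorizations_split fz Az.
have atA : atoms A by case: fz => + _; apply.
have sA : A `<=` pair_mset g i j by rewrite E msub_addl.
have lei : i <= n by move: ij; rewrite !inE => /or3P [] /eqP [? ?]; lia.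
have lej : j <= n by move: ij; rewrite !inE => /or3P [] /eqP [? ?]; lia.
suff <- : A = pair_mset g i j by [].
have [AE le1 le2] := pair_mset_sub gh sA.
have := atoms_pair_sub lei lej sA atA; move: ij le1 le2; rewrite !inE => ij le1 le2.
move=> H; have {H} : [\/ A g = 1 /\ A g^-1%g = 1, A g = n /\ A g^-1%g = 0 | A g = 0 /\ A g^-1%g = n].
  by case: H => ->; rewrite !pair_msetE // !eqxx eq_sym (negPf gh);
    [constructor 1|constructor 2|constructor 3].
move=> H; rewrite AE; congr pair_mset; move: ij => /or3P [] /eqP [? ?]; case: H => -[? ?]; lia.
Qed.

(** The atoms g^n and g^-n complement each other; without them only g g^-1 is
    left. *)
Lemma lengths_order m : lengths (pair_mset g n n) m%:Z -> m = 2 \/ m = n.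
Proof.
move=> /lengthsP [z fz <-].
have cut A B : A \in z -> atoms B -> pair_mset g n n = A `+` B -> size z = 2.
  move=> Az atB E; have [T [w [-> E' fw]]] := factorizations_split fz Az.
  have TB : T = B by apply: (@msetDI _ A); rewrite -E -E'.
  by rewrite TB in fw; rewrite (factorizations_atom atB fw) size_mset_cons enum_msetn.
have [nz|nz] := boolP (pair_mset g n 0 \in z).
  left; apply: (cut _ (pair_mset g 0 n) nz); first by apply: atoms_pair; rewrite !inE eqxx !orbT.
  by apply/msetP => x; rewrite msetE2 !pair_msetE //; do 2?[case: eqP => _]; lia.
have [nz'|nz'] := boolP (pair_mset g 0 n \in z).
  left; apply: (cut _ (pair_mset g n 0) nz'); first by apply: atoms_pair; rewrite !inE eqxx !orbT.
  by apply/msetP => x; rewrite msetE2 !pair_msetE //; do 2?[case: eqP => _]; lia.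
right; have size2 A : A \in z -> size A = 2.
  move=> Az; have [T [w [_ E _]]] := factorizations_split fz Az.
  have atA : atoms A by case: fz => + _; apply.
  have sA : A `<=` pair_mset g n n by rewrite E msub_addl.
  case: (atoms_pair_sub (leqnn _) (leqnn _) sA atA) => AE.
  - by rewrite AE size_msetD !enum_msetn.
  - by rewrite AE (negPf nz) in Az.
  - by rewrite AE (negPf nz') in Az.
have : size (pair_mset g n n) = size z * 2.
  case: fz => _ <-; have {}size2 : forall A, A \in (z : seq _) -> size A = 2 by [].
  elim: (z : seq _) size2 => [|A s IHs] size2; first by rewrite big_nil size_mset0.
  rewrite big_cons size_msetD size2 ?mem_head // IHs // => B Bs.
  by apply: size2; rewrite inE Bs orbT.
by rewrite size_msetD !enum_msetn !size_nseq; lia.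
Qed.

Lemma has_relation_order : has_relation (pair_mset g n n).
Proof.
split; last exists n; last by lia.
- apply/(lengthsP _ 2); exists [mset pair_mset g n 0; pair_mset g 0 n]; last first.
    by rewrite size_mset_cons enum_msetn.
  have -> : pair_mset g n n = pair_mset g n 0 `+` pair_mset g 0 n.
    by apply/msetP => x; rewrite msetE2 !pair_msetE //; do 2?[case: eqP => _]; lia.
  apply: factorizations_cons; last apply: factorizations1;
    by apply: atoms_pair; rewrite !inE eqxx ?orbT.
apply/lengthsP; exists (msetn n (pair_mset g 1 1)); last by rewrite enum_msetn size_nseq.
have : forall m, factorizations (pair_mset g m m) (msetn m (pair_mset g 1 1)); last exact.
elim=> [|m IHm].
  rewrite msetn0; have -> : pair_mset g 0 0 = mset0 by apply/eqP; rewrite pair_mset_eq0.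
  exact: factorizations0.
have -> : msetn m.+1 (pair_mset g 1 1) = pair_mset g 1 1 +` msetn m (pair_mset g 1 1).
  by apply/msetP => A; rewrite msetE2 !msetnE; case: eqP.
have -> : pair_mset g m.+1 m.+1 = pair_mset g 1 1 `+` pair_mset g m m.
  by apply/msetP => x; rewrite msetE2 !pair_msetE //; do 2?[case: eqP => _]; lia.
by apply: factorizations_cons => //; apply: atoms_pair; rewrite !inE eqxx.
Qed.

End Order.

Lemma reaches3_order g : reaches3 gT -> #[g] <= 3.
Proof.
move=> r3; rewrite leqNgt; apply/negP => lt3.
have lt2 : 2 < #[g] by lia.
have [L2 [m Lm m2]] := has_relation_order lt2.
by have := lengths_order lt2 (r3 _ _ L2 Lm m2 : lengths _ 3%N%:Z); lia.
Qed.

Lemma has_relation_C2xC2 (a b : gT) : (a ^+ 2 = 1)%g -> (b ^+ 2 = 1)%g -> commute a b ->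
  a != 1%g -> b != 1%g -> a != b -> exists S : {mset gT}, has_relation S.
Proof.
move=> a2 b2 ab a1 b1 nab; set f := monomial a b 1.
have fM (x y : expo3) : (f (mul_add x y) = f x * f y)%g.
  by apply: monomial_add => //; [exact: commute1|exact: commute1].
pose one2 (x : expo3) := (2 %| x.1.1) && (2 %| x.1.2).
have fK (x : expo3) : f x = 1%g <-> one2 x.
  case: x => [[i j] k]; rewrite /f /monomial /one2 /= expg1n mulg1; split; last first.
    by move=> /andP [i2 j2]; rewrite (expg_dvd a2) // (expg_dvd b2) // mulg1.
  rewrite -(expg_mod i a2) -(expg_mod j b2) !modn2 !dvdn2.
  case: (odd i); case: (odd j) => //=; rewrite ?expg0 ?expg1 ?mulg1 ?mul1g => E.
  - by case/eqP: nab; apply: (mulIg b); rewrite E -b2 expgS expg1.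
  - by rewrite E eqxx in a1.
  - by rewrite E eqxx in b1.
pose cs : seq expo3 := [:: (1, 0, 0); (0, 1, 0); (1, 1, 0)].
exists (mset_vec (map f cs) (vsum (size (map f cs)) [:: [:: 1; 1; 1]; [:: 1; 1; 1]])).
apply: (@has_relation_vec _ _ (po_perm mul_add one2 cs) _ _ [:: [:: 2; 0; 0]; [:: 0; 2; 0]; [:: 0; 0; 2]]).
  by move=> v _; apply: po_permP => //; exact: monomial1.
by vm_compute.
Qed.

Lemma has_relation_card : 2 < #|gT| -> exists S : {mset gT}, has_relation S.
Proof.
move=> G3; have [[g g3]|small] := pselect (exists g : gT, 2 < #[g]).
  by exists (pair_mset g #[g] #[g]); exact: has_relation_order.
have sq (g : gT) : (g ^+ 2 = 1)%g.
  have : #[g] <= 2 by rewrite leqNgt; apply/negP => g3; apply: small; exists g.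
  have := order_gt0 g; case E: #[g] => [|[|[|m]]] // _ _; last by rewrite -E expg_order.
  by move/eqP: E; rewrite order_eq1 => /eqP ->; rewrite expg1n.
have [a a1] : exists a, a \notin [set 1%g : gT].
  apply/existsP; rewrite -negb_forall; apply/negP => /forallP H.
  have : #|[set: gT]| <= #|[set 1%g : gT]| by apply/subset_leq_card/fintype.subsetP => x _.
  by rewrite cardsT cards1 => /(leq_trans G3).
have [b bab] : exists b, b \notin [set 1%g; a].
  apply/existsP; rewrite -negb_forall; apply/negP => /forallP H.
  have : #|[set: gT]| <= #|[set 1%g; a]| by apply/subset_leq_card/fintype.subsetP => x _.
  by rewrite cardsT cards2 => /(leq_trans G3); case: eqP.
rewrite !inE in a1 bab; case/norP: bab => b1 ba.
apply: (@has_relation_C2xC2 a b) => //; last by rewrite eq_sym.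
have i2 (x : gT) : (x^-1 = x)%g by apply: (mulgI x); rewrite mulgV -(sq x) expgS expg1.
by rewrite /commute -[LHS]i2 invMg !i2.
Qed.

End Cyclic.

(** * Groups in which 2 is followed by 3 in sets of lengths *)

Section Classification.

Local Open Scope group_scope.

Variable gT : finGroupType.
Implicit Types (a b c g r s t u x y : gT).

Section Exponent3.

Hypothesis exp3 : forall x, x ^+ 3 = 1.

(** The identity (xy)^3 = 1 solved for xyx. *)
Lemma exp3_mul x y : x * y * x = y^-1 * x^-1 * y^-1.
Proof.
apply: (mulIg (y * (x * y))); apply: etrans (_ : 1 = _).
  by rewrite -(exp3 (x * y)) !expgS expg0 mulg1 !mulgA.
by rewrite !mulgA mulgKV mulgKV mulVg.
Qed.

Lemma exp3_sqr x : x * x = x^-1.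
Proof. by apply: (mulIg x); rewrite mulVg -(exp3 x) !expgS expg0 mulg1 !mulgA. Qed.

(** Groups of exponent 3 are 2-Engel: both x x^y and x^y x reduce to
    y x^-1 y^-1 by [exp3_mul]. *)
Lemma exp3_commute_conj x y : commute x (x ^ y).
Proof.
have yy : y^-1 * y^-1 = y by rewrite exp3_sqr invgK.
rewrite /commute conjgE; apply: etrans (_ : y * x^-1 * y^-1 = _).
  have -> : x * (y^-1 * (x * y)) = x * (y^-1 * x * y^-1) * y^-1.
    by rewrite -!mulgA yy.
  by rewrite exp3_mul invgK !mulgA mulgV mul1g.
have -> : y^-1 * (x * y) * x = y^-1 * (x * y * x) by rewrite !mulgA.
by rewrite exp3_mul !mulgA yy.
Qed.

End Exponent3.

Section Reaching.

Hypothesis r3 : reaches3 gT.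

Lemma order_cases g : g ^+ 2 = 1 \/ g ^+ 3 = 1.
Proof.
have := reaches3_order g r3; have := order_gt0 g.
case E: #[g] => [|[|[|[|m]]]] // _ _; last by right; rewrite -E expg_order.
  by left; move/eqP: E; rewrite order_eq1 => /eqP ->; rewrite expg1n.
by left; rewrite -E expg_order.
Qed.

Lemma invol_inv s : s ^+ 2 = 1 -> s^-1 = s.
Proof. by move=> s2; apply: (mulgI s); rewrite mulgV -s2 expgS expg1. Qed.

Lemma invol_sq s : s ^+ 2 = 1 -> s * s = 1.
Proof. by rewrite expgS expg1. Qed.

(** Noncommuting involutions generate a copy of S3, as their product has
    order 3. *)
Lemma invol_commute s t : s ^+ 2 = 1 -> t ^+ 2 = 1 -> commute s t.
Proof.
move=> s2 t2; have [st2|st3] := order_cases (s * t).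
  by rewrite /commute -(invol_inv st2) invMg !invol_inv.
apply: contrapT => nst; apply: (@not_reaches3_S3 _ (s * t) s st3 s2) r3.
- have -> : (s * t) ^+ 2 = t * s.
    apply: (mulIg (s * t)); rewrite -expgSr st3 !mulgA -(mulgA t s).
    by rewrite invol_sq // mulg1 invol_sq.
  by rewrite mulgA -(mulgA t) !invol_sq // mul1g mulg1.
- apply/eqP => st1; apply: nst; rewrite /commute st1 -(invol_inv s2) -(invol_inv t2).
  by rewrite -invMg st1 invg1.
- by apply/eqP => s1; apply: nst; rewrite s1; apply/commute_sym/commute1.
Qed.

(** Let g have order 3 and t be an involution. The conjugates t, u, w of t under
    the powers of g commute, so tuw is centralized by g, and it is trivial since
    otherwise its product with g has order 6. Hence g, t and u generate a copy
    of A4. *)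
Lemma exponent23 : (forall x, x ^+ 2 = 1) \/ (forall x, x ^+ 3 = 1).
Proof.
have [|/existsNP [g g2]] := pselect (forall x, x ^+ 2 = 1); first by left.
have g3 : g ^+ 3 = 1 by have [] := order_cases g.
have g1 : g != 1 by apply/eqP => g1; apply: g2; rewrite g1 expg1n.
right=> t; have [t2|//] := order_cases t.
have cent_invol v : v ^+ 2 = 1 -> commute v g -> v = 1.
  move=> v2 vg; have [] := order_cases (v * g); rewrite expgMn //.
    by rewrite v2 mul1g.
  by rewrite g3 mulg1 expgS v2 mulg1.
have conj2 x : x ^+ 2 = 1 -> (x ^ g^-1) ^+ 2 = 1 by move=> x2; rewrite -conjXg x2 conj1g.
have [u [w [u2 w2 gt gu gw]]] : exists u w,
    [/\ u ^+ 2 = 1, w ^+ 2 = 1, g * t = u * g, g * u = w * g & g * w = t * g].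
  exists (t ^ g^-1), ((t ^ g^-1) ^ g^-1); split.
  - exact: conj2.
  - exact: (conj2 _ (conj2 _ t2)).
  - exact: conjgCV.
  - exact: conjgCV.
  have gg : g^-1 * g^-1 = g.
    by rewrite -invMg; apply: (mulgI (g * g)); rewrite mulgV -g3 !expgS expg0 mulg1 mulgA.
  by rewrite -conjgM gg conjgE mulKVg.
have tuw : t * u * w = 1.
  apply: cent_invol.
    rewrite expgMn; last by apply/commute_sym/commuteM; exact: invol_commute.
    by rewrite w2 mulg1 expgMn ?t2 ?u2 ?mulg1 //; exact: invol_commute.
  have -> : commute (t * u * w) g <-> t * u * w * g = u * w * t * g.
    have -> : u * w * t * g = g * (t * u * w) by rewrite -mulgA -gw !mulgA -(mulgA u w g) -gu !mulgA -gt.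
    by [].
  by congr (_ * g); rewrite -mulgA; apply: commuteM; exact: invol_commute.
have [->|t1] := eqVneq t 1; first by rewrite expg1n.
case: (@not_reaches3_A4 _ t u g) r3 => //; first exact: invol_commute.
- rewrite gu; congr mulg; apply: (mulgI (t * u)); rewrite tuw invol_sq //.
  by rewrite expgMn ?t2 ?u2 ?mulg1 //; exact: invol_commute.
- by apply: contraNneq t1 => u1; apply/eqP/(mulgI g); rewrite gt u1 mul1g mulg1.
- by apply: contraNneq t1 => tu; apply/eqP/cent_invol; rewrite // /commute gt -tu.
Qed.

(** In exponent 3 the commutator of a and b is central in the group generated by
    them ([exp3_commute_conj]), so this is a Heisenberg group unless a and b
    commute. *)
Lemma reaches3_abelian : forall x y, commute x y.
Proof.
have [e2|e3] := exponent23; first by move=> x y; exact: invol_commute.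
move=> a b; apply: contrapT => nab.
have cE : b * a = a * b * [~ b, a] by rewrite -commgC.
apply: (@not_reaches3_heisenberg _ a b [~ b, a]) r3 => //; try exact: e3.
- rewrite commgEr; apply/commute_sym/commuteM => //.
  by rewrite conjVg; exact/commuteV/exp3_commute_conj.
- rewrite commgEl; apply/commute_sym/commuteM; last exact: exp3_commute_conj.
  exact: commuteV.
- apply/eqP => c1; apply: nab; rewrite /commute cE c1 mulg1 //.
Qed.

Lemma card_le_sqr p : p \in [:: 2; 3]%N -> (forall x, x ^+ p = 1) -> (#|gT| <= p ^ 2)%N.
Proof.
move=> p23 ep; have abelG := reaches3_abelian.
have pr : prime p by move: p23; rewrite !inE => /orP [] /eqP ->.
have oP x : (#|<[x]>| <= p)%N.
  by rewrite -orderE dvdn_leq ?prime_gt0 // order_dvdn ep.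
have [a a1|all1] := pickP (fun a => a != 1); last first.
  have : #|[set: gT]| <= #|[set 1 : gT]|.
    by apply/subset_leq_card/fintype.subsetP => x _; rewrite inE; have /negbFE := all1 x.
  by rewrite cardsT cards1 => /leq_trans; apply; rewrite expn_gt0 prime_gt0.
have [b ba|alla] := pickP (fun b => b \notin <[a]>); last first.
  have : #|[set: gT]| <= #|<[a]>|.
    by apply/subset_leq_card/fintype.subsetP => x _; have /negbFE := alla x.
  rewrite cardsT => /leq_trans; apply; rewrite (leq_trans (oP a)) //.
  by rewrite -{1}[p]expn1 leq_exp2l ?prime_gt1.
have [c cab|allab] := pickP (fun c => c \notin <<[set a; b]>>).
  by case: (not_reaches3_rank3 abelG p23 ep a1 ba cab r3).
have : #|[set: gT]| <= #|<[a]> * <[b]>|.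
  apply/subset_leq_card/fintype.subsetP => x _; have /negbFE := allab x.
  rewrite -cent_joinEl ?joing_idl ?joing_idr //.
  by rewrite cent_cycle cycle_subG; apply/cent1P; exact: abelG.
rewrite cardsT => /leq_trans; apply.
have := mul_cardG <[a]> <[b]>; have := oP a; have := oP b; rewrite -mulnn.
move=> ob oa E; apply: (@leq_trans (#|<[a]>| * #|<[b]>|)); last exact: leq_mul.
by rewrite E leq_pmulr // cardG_gt0.
Qed.

End Reaching.

Definition small_abelem : Prop :=
  [\/ 3.-abelem [set: gT] /\ #|gT| = 3, 2.-abelem [set: gT] /\ #|gT| = 4
    | 3.-abelem [set: gT] /\ #|gT| = 9].

Lemma reaches3_small_abelem : reaches3 gT -> (2 < #|gT|)%N -> small_abelem.
Proof.
move=> r3 G3.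
have H p : p \in [:: 2; 3]%N -> (forall x : gT, x ^+ p = 1) ->
    p.-abelem [set: gT] /\ exists2 n, (n <= 2)%N & #|gT| = (p ^ n)%N.
  move=> p23 ep; have pr : prime p by move: p23; rewrite !inE => /orP [] /eqP ->.
  have abG : p.-abelem [set: gT].
    apply/abelemP => //; split=> [|x _]; last exact: ep.
    by apply/centsP => x _ y _; exact: reaches3_abelian.
  split=> //; have /p_natP [n E] := abelem_pgroup abG.
  rewrite cardsT in E; exists n => //; rewrite -(@leq_exp2l p) ?prime_gt1 // -E.
  exact: card_le_sqr.
have [/(H 2 isT) [ab [n len E]]|/(H 3 isT) [ab [n len E]]] := exponent23 r3;
  rewrite E in G3; case: n len E G3 => [|[|[|n]]] // _ E _.
- by constructor 2.
- by constructor 1.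
- by constructor 3.
Qed.

End Classification.

Section ElementaryTargets.

Local Open Scope group_scope.

Lemma abelem_Zp p : prime p -> p.-abelem [set: 'Z_p] /\ #|[set: 'Z_p]| = p.
Proof.
move=> pr; have cZ : #|[set: 'Z_p]| = p by rewrite cardsT card_ord Zp_cast ?prime_gt1.
by split=> //; exact: prime_abelem.
Qed.

Lemma abelem_Zp2 p : prime p ->
  p.-abelem [set: 'Z_p * 'Z_p] /\ #|[set: 'Z_p * 'Z_p]| = (p ^ 2)%N.
Proof.
move=> pr; have [/abelemP [//|abZ eZ] cZ] := abelem_Zp pr.
split; last by rewrite cardsT card_prod -!cardsT cZ mulnn.
apply/abelemP => //; split=> [|[x y] _].
  apply/centsP => -[x1 y1] _ [x2 y2] _; congr pair.
    by apply: (centsP abZ); rewrite inE.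
  by apply: (centsP abZ); rewrite inE.
have E n : (x, y) ^+ n = (x ^+ n, y ^+ n).
  by elim: n => [|n IH] //; rewrite !expgS IH.
by rewrite E !eZ ?inE.
Qed.

Lemma small_abelemP (gT : finGroupType) : small_abelem gT <->
  [\/ [set: gT] \isog [set: 'Z_3], [set: gT] \isog [set: 'Z_2 * 'Z_2]
    | [set: gT] \isog [set: 'Z_3 * 'Z_3]].
Proof.
have [a3 c3] := @abelem_Zp 3 isT.
have [a4 c4] := @abelem_Zp2 2 isT; have [a9 c9] := @abelem_Zp2 3 isT.
split=> [[] [ab cG]|[] iG].
- by constructor 1; rewrite (isog_abelem_card _ ab) a3 c3 cardsT cG.
- by constructor 2; rewrite (isog_abelem_card _ ab) a4 c4 cardsT cG.
- by constructor 3; rewrite (isog_abelem_card _ ab) a9 c9 cardsT cG.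
- by constructor 1; rewrite (isog_abelem iG) a3 -cardsT (card_isog iG) c3.
- by constructor 2; rewrite (isog_abelem iG) a4 -cardsT (card_isog iG) c4.
- by constructor 3; rewrite (isog_abelem iG) a9 -cardsT (card_isog iG) c9.
Qed.

End ElementaryTargets.

(** * Exponent vectors over C3 x C3 *)

(** The group C3 x C3 in terms of exponents with respect to a basis. The third
    component of an exponent triple is always 0 here. *)
Definition add3 (x y : expo3) : expo3 :=
  ((x.1.1 + y.1.1) %% 3, (x.1.2 + y.1.2) %% 3, 0).

Definition one3 (x : expo3) := (3 %| x.1.1) && (3 %| x.1.2).

Definition exponents9 : seq expo3 := [:: (0,0,0); (0,1,0); (0,2,0); (1,0,0); (1,1,0); (1,2,0);
  (2,0,0); (2,1,0); (2,2,0)].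

Definition vec9 (l : seq expo3) : seq nat := [seq count_mem c l | c <- exponents9].

Definition atom9 := atomv (po_abel add3 one3 exponents9).

(** The two shapes x^2 y^2 (xy) and x y (xy)^2 of an atom with more than three
    terms. *)
Definition long9 (t : bool) (x y : expo3) : seq expo3 :=
  let z := add3 x y in if t then [:: x; x; y; y; z] else [:: x; y; z; z].

Fixpoint vle (v w : seq nat) : bool :=
  match v, w with n :: v', m :: w' => if n <= m then vle v' w' else false | _, _ => true end.

Definition short_atoms9 : seq (seq nat) :=
  undup [seq v <- [seq vec9 [:: x; y; add3 (add3 x x) (add3 y y)] | x <- exponents9, y <- exponents9] ++
    [seq vec9 [:: x; add3 x x] | x <- exponents9] | atom9 v].

Definition atoms9 : seq (seq nat) :=
  short_atoms9 ++ undup [seq v <- [seq vec9 (long9 true x y) | x <- exponents9, y <- exponents9] ++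
    [seq vec9 (long9 false x y) | x <- exponents9, y <- exponents9] | atom9 v].

(** For the sum v of two long atoms, this is the hypothesis of
    [chain_connected_abel] with N = 3. *)
Definition splits_short (shorts alls : seq (seq nat)) v : bool :=
  has (fun w1 => if vle w1 v then let r := vsub v w1 in
     if atom9 r then true else
     has (fun w2 => if vle w2 r then atom9 (vsub r w2) else false) alls
     else false) shorts.

(** An atom that contains a and b and has more than three terms contains exactly
    one of ab, ab^2 and a^2 b. Accordingly it has one of the shapes of [long9]
    for x, y equal to a, b or to ab^2, b or to a, a^2 b. *)
Definition bases9 : seq (expo3 * expo3) :=
  [:: ((1,0,0), (0,1,0)); ((1,2,0), (0,1,0)); ((1,0,0), (2,1,0))].

Definition forms9 : seq (seq expo3) := [seq long9 t xy.1 xy.2 | xy <- bases9, t <- [:: true; false]].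

Definition long_pairs_ok (shorts alls : seq (seq nat)) : bool :=
  all (fun x => all (fun y => all (fun t => let l := long9 t x y in
    if atom9 (vec9 l) then all (fun k => splits_short shorts alls (vec9 (k ++ l))) forms9
    else true) [:: true; false]) exponents9) exponents9.

(** The bounds on the entries are those of an atom that has more than three terms
    and contains a and b: it contains neither 1 nor the inverses of a, b and ab,
    and it does not contain the cube of an element. The positions 3 and 1 are
    those of a and b. *)
Definition long_forms_ok : bool :=
  all (fun v => if 3 < sumn v then if 0 < nth 0 v 3 then if 0 < nth 0 v 1 then
      if atom9 v then has (fun l => v == vec9 l) forms9 else true else true else true else true)
    (subvecs [:: 0;2;0;2;2;2;0;2;0]).

Lemma long_pairs_okT : long_pairs_ok short_atoms9 atoms9. Proof. by vm_compute. Qed.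

Lemma long_forms_okT : long_forms_ok. Proof. by vm_compute. Qed.

Definition atom_lists_ok (shorts alls : seq (seq nat)) : bool :=
  all (fun v => if sumn v <= 3 then if size v == 9 then atom9 v else false else false) shorts
  && all (fun v => (size v == 9) && atom9 v) alls.

Lemma atom_lists_okT : atom_lists_ok short_atoms9 atoms9. Proof. by vm_compute. Qed.

Lemma inj9 : all (fun x => all (fun y =>
  if one3 (add3 x (add3 y y)) then x == y else true) exponents9) exponents9.
Proof. by vm_compute. Qed.

Lemma closed9 : all (fun x => all (fun y => add3 x y \in exponents9) exponents9) exponents9.
Proof. by vm_compute. Qed.

Lemma vle_subvecs v w : size v = size w -> vle v w -> v \in subvecs w.
Proof.
elim: v w => [|n v IH] [|m w] //= [sv]; case: leqP => // le_nm le_vw.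
by apply: mem_subvecs => //; exact: IH.
Qed.

Section Counts.

Variable gT : finGroupType.
Implicit Types (A B S T : {mset gT}).

Lemma mset_vec_count (gs : seq gT) A : uniq gs -> (forall x, x \in A -> x \in gs) ->
  A = mset_vec gs (map A gs).
Proof.
move=> ugs sA; apply/msetP => x.
have -> : mset_vec gs (map A gs) x = if x \in gs then A x else 0.
  elim: gs ugs {sA} => [|g gs IH] /=; first by rewrite mset_seqE.
  move=> /andP [ngs /IH E]; rewrite mset_vec_cons msetE2 msetnE E inE.
  by case: (eqVneq x g) => [->|] //=; rewrite (negPf ngs) addn0.
by case: ifPn => // xgs; apply/eqP; rewrite mset_eq0; apply: contraNN xgs => /sA.
Qed.

Lemma mset_vec_map (f : expo3 -> gT) cs l : uniq cs -> {subset l <= cs} ->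
  {in cs &, injective f} ->
  seq_mset (map f l) = mset_vec (map f cs) [seq count_mem c l | c <- cs].
Proof.
move=> ucs slc finj; rewrite {1}(@mset_vec_count (map f cs) (seq_mset (map f l))).
- rewrite -map_comp; congr mset_vec; apply/eq_in_map => c ccs /=.
  rewrite mset_seqE count_map; apply/eq_in_count => d /slc dcs /=.
  by apply/eqP/eqP => [|->] // /finj ->.
- by rewrite map_inj_in_uniq.
- move=> x; rewrite in_mset mset_seqE -has_count has_pred1 => /mapP [c /slc ccs ->].
  exact: map_f.
Qed.

Lemma size_mset_sum A : size A = \sum_(x : gT) A x.
Proof.
rewrite -[LHS]size_seq_mset seq_mset_id.
rewrite -sum1_size (@partition_big _ _ _ _ _ _ xpredT id xpredT) //=.
apply: eq_bigr => x _; rewrite -count_mem_mset -sum1_count.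
by apply: eq_bigl.
Qed.

End Counts.

(** * Long atoms over elementary abelian groups *)

Section LongAtoms.

Variables (gT : finGroupType) (p : nat).
Implicit Types (A B S T : {mset gT}) (x a b : gT).
Hypotheses (abelG : forall x y : gT, commute x y) (p23 : p \in [:: 2; 3]).
Hypothesis expG : forall x : gT, (x ^+ p = 1)%g.

(** In an abelian group the complement of T in A is product-one, so it is empty. *)
Lemma atom_sub A T : atoms A -> T `<=` A -> product_one T -> T != mset0 -> T = A.
Proof.
move=> atA sTA poT T0; have AE := msubD sTA.
have poU : product_one (A `\` T).
  by apply: (product_one_cancel abelG _ poT); rewrite -AE; exact: atoms_product_one.
have [T0'|U0] := atom_dvd atA poT poU AE; first by rewrite T0' eqxx in T0.
by rewrite [RHS]AE U0 msetD0.
Qed.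

Lemma atom_seq_sub A (s : seq gT) : atoms A -> s != [::] -> seq_mset s `<=` A ->
  (\prod_(x <- s) x = 1)%g -> size A = size s.
Proof.
move=> atA s0 sA s1; rewrite -(atom_sub atA sA (product_one_seq s1)) ?size_seq_mset //.
by rewrite -mset_size_gt0 size_seq_mset lt0n size_eq0.
Qed.

Variable A : {mset gT}.
Hypotheses (atA : atoms A) (ltA : p < size A).

Lemma long_atom_seq (s : seq gT) : s != [::] -> (\prod_(x <- s) x = 1)%g ->
  (forall x, count_mem x s <= A x) -> size A = size s.
Proof.
by move=> s0 s1 sA; apply: atom_seq_sub => //; apply/msubsetP => x; rewrite mset_seqE.
Qed.

Lemma long_atom1 : A 1%g = 0.
Proof.
apply/eqP; rewrite -leqn0 leqNgt; apply/negP => A1.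
have := @long_atom_seq [:: 1%g] isT; rewrite big_seq1 => /(_ erefl) H.
have := ltA; rewrite H => [|x /=]; first by move: p23; rewrite !inE => /orP [] /eqP ->.
by rewrite addn0; case: eqP => // <-.
Qed.

Lemma long_atom_lt x : A x < p.
Proof.
rewrite ltnNge; apply/negP => le_pA; have := ltA.
rewrite (@long_atom_seq (nseq p x)) ?size_nseq ?ltnn //.
- by move: p23; rewrite !inE => /orP [] /eqP ->.
- by rewrite big_nseq -Monoid.iteropE; exact: expG.
- by move=> y; rewrite count_nseq /=; case: eqP => [<-|_]; rewrite ?mul1n.
Qed.

(** For p = 2 each element occurs at most once; for p = 3 it occurs at most twice,
    and not together with its inverse. *)
Lemma long_atom_inv x : x != 1%g -> A x + A x^-1%g <= 2.
Proof.
move=> x1; have := long_atom_lt x; have := long_atom_lt x^-1%g.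
have [xx|nxx] := eqVneq x x^-1%g.
  have : p != 3.
    apply: contraNneq x1 => p3; have := expG x; rewrite p3 expgS expgS expg1.
    by rewrite {2}xx mulVg mulg1 => ->.
  by move: p23; rewrite !inE => /orP [] /eqP ->; lia.
have [Ax|] := ltnP 0 (A x); last by move: p23; rewrite !inE => /orP [] /eqP ->; lia.
have [Ax'|] := ltnP 0 (A x^-1%g); last by move: p23; rewrite !inE => /orP [] /eqP ->; lia.
have := ltA; rewrite (@long_atom_seq [:: x; x^-1%g]) //.
- by move: p23; rewrite !inE => /orP [] /eqP ->.
- by rewrite !big_cons big_nil mulg1 mulgV.
- move=> y /=; have [<-|_] := eqVneq x y; last by case: eqP => // <-.
  by rewrite eq_sym (negPf nxx).
Qed.

(** Summing [long_atom_inv] over the nontrivial elements of H counts each term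
    of A twice. *)
Lemma long_atom_size (H : {group gT}) : (forall x, x \in A -> x \in H) -> size A < #|H|.
Proof.
move=> sAH; suff : (size A).*2 <= (#|H|.-1).*2.
  by rewrite leq_double; have := cardG_gt0 H; lia.
have E : size A = \sum_(x in H^#) A x.
  rewrite size_mset_sum (bigID (mem H^#)) /= [X in _ + X]big1 ?addn0 // => x.
  rewrite !inE negb_and negbK => /orP [/eqP ->|xH]; first exact: long_atom1.
  by apply/eqP; rewrite mset_eq0; apply: contraNN xH => /sAH.
have E' : size A = \sum_(x in H^#) A x^-1%g.
  rewrite E (reindex_inj invg_inj); apply: eq_bigl => x.
  by rewrite !inE groupV invg_eq1.
rewrite -addnn {1}E E' -big_split /= -muln2 (cardsD1 1%g H) group1 /= add0n.
rewrite -sum_nat_const; apply: leq_sum => x; rewrite !inE => /andP [x1 _].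
exact: long_atom_inv.
Qed.

End LongAtoms.

(** * Long atoms over C3 x C3 *)

Section C3xC3.

Variables (gT : finGroupType).
Implicit Types (A B S T : {mset gT}) (x a b : gT).
Hypotheses (abelG : forall x y : gT, commute x y).
Hypothesis expG : forall x : gT, (x ^+ 3 = 1)%g.
Hypothesis card9 : #|gT| = 9.

Section Basis.

Variables (a b : gT).
Hypotheses (a1 : a != 1%g) (ba : b \notin <[a]>%g).

Let f := monomial a b 1%g.

Definition gs9 := map f exponents9.

Lemma f9M (x y : expo3) : (f (add3 x y) = f x * f y)%g.
Proof.
case: x y => [[i j] k] [[i' j'] k']; rewrite /f /monomial /= !expg1n !mulg1 !expg_mod // !expgD.
rewrite !mulgA; congr mulg; rewrite -!mulgA; congr mulg; exact: commuteX2.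
Qed.

Lemma f9K (x : expo3) : f x = 1%g <-> one3 x.
Proof.
case: x => [[i j] k]; rewrite /f /monomial /one3 /= expg1n mulg1; split; last first.
  by move=> /andP [pi pj]; rewrite (expg_dvd (expG a)) // (expg_dvd (expG b)) // mulg1.
move=> ab; have jp : (3 %| j)%N.
  apply: (@expg_cancel_prime _ <[a]>%G _ b) => //.
  have -> : (b ^+ j = (a ^+ i)^-1)%g by apply: (mulgI (a ^+ i)%g); rewrite ab mulgV.
  by rewrite groupV mem_cycle.
rewrite (expg_dvd (expG b) jp) mulg1 in ab.
by rewrite jp -(expg_prime_eq1 i _ (expG a)) // ab eqxx.
Qed.

Lemma f9_inj : {in exponents9 &, injective f}.
Proof.
move=> x y xF yF E; have /allP /(_ x xF) /allP /(_ y yF) := inj9.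
rewrite ifT; first by move/eqP.
by apply/f9K; rewrite !f9M E -[RHS](expG (f y)) !expgS expg0 mulg1.
Qed.

Lemma uniq_gs9 : uniq gs9.
Proof. by rewrite map_inj_in_uniq //; exact: f9_inj. Qed.

Lemma mem_gs9 x : x \in gs9.
Proof.
have : gs9 =i predT by apply/subset_cardP; rewrite ?subset_predT // (card_uniqP uniq_gs9) /= card9.
by move=> ->.
Qed.

Lemma atom9P v : size v = 9 -> atoms (mset_vec gs9 v) <-> atom9 v.
Proof.
move=> sv; apply: atomvP; last by rewrite size_map.
move=> w _; apply: (po_abelP (mul := add3)) => //; [exact: monomial1|exact: f9M|exact: f9K].
Qed.

Lemma add3_exponents9 (x y : expo3) : x \in exponents9 -> y \in exponents9 -> add3 x y \in exponents9.
Proof. by move=> xF yF; have /allP /(_ x xF) /allP /(_ y yF) := closed9. Qed.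

Lemma long9_exponents9 t (x y : expo3) :
  x \in exponents9 -> y \in exponents9 -> {subset long9 t x y <= exponents9}.
Proof.
move=> xF yF; have zF := add3_exponents9 xF yF; apply/allP.
by rewrite /long9; case: t => /=; rewrite xF yF zF.
Qed.

Lemma seq_mset9 (l : seq expo3) : {subset l <= exponents9} -> seq_mset (map f l) = mset_vec gs9 (vec9 l).
Proof. by move=> lF; rewrite (@mset_vec_map _ f exponents9) //; exact: f9_inj. Qed.

Lemma forms9_exponents9 l : l \in forms9 -> {subset l <= exponents9}.
Proof.
move=> /allpairsP [[[x y] t] /= [xy _ ->]]; apply: long9_exponents9;
  by move: xy; rewrite /bases9 !inE => /or3P [] /eqP [? ?]; subst x y; vm_compute.
Qed.

Lemma no_short_code A l : atoms A -> 3 < size A -> uniq l -> {subset l <= exponents9} ->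
  l != [::] -> size l <= 3 -> one3 (eval add3 l) -> ~ all (fun c => f c \in A) l.
Proof.
move=> atA ltA ul lF l0 sl one lA; have fl1 : (\prod_(x <- map f l) x = 1)%g.
  rewrite (evalE (mul := add3)); [exact/f9K|exact: monomial1|exact: f9M].
suff : size A = size l by lia.
rewrite -(size_map f l); apply: (atom_seq_sub abelG atA) => //; first by case: (l) l0.
apply/msubsetP => x; rewrite mset_seqE count_uniq_mem; last first.
  by rewrite map_inj_in_uniq // => c d /lF cF /lF dF; exact: f9_inj.
by case: (boolP (x \in _)) => // /mapP [c cl ->]; have /allP /(_ c cl) := lA; rewrite in_mset.
Qed.

Lemma long_atom_forms A : atoms A -> 3 < size A -> a \in A -> b \in A ->
  exists2 l, l \in forms9 & A = seq_mset (map f l).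
Proof.
move=> atA ltA aA bA; have AE := mset_vec_count uniq_gs9 (fun x (_ : x \in A) => mem_gs9 x).
have fa : f (1, 0, 0) = a by rewrite /f /monomial /= !mulg1.
have fb : f (0, 1, 0) = b by rewrite /f /monomial /= mulg1 mul1g.
have lt3 x : A x <= 2 by have := long_atom_lt abelG (isT : 3 \in [:: 2; 3]) expG atA ltA x; lia.
have no l : all (fun c => f c \in A) l -> uniq l && all (mem exponents9) l && (l != [::]) &&
    (size l <= 3) && one3 (eval add3 l) -> False.
  move=> lA /andP [/andP [/andP [/andP [ul /allP lF] l0] sl] one].
  exact: (no_short_code atA ltA ul lF l0 sl one lA).
have zero c l : all (fun c => f c \in A) l -> uniq (c :: l) && all (mem exponents9) (c :: l) &&
    (c :: l != [::]) && (size (c :: l) <= 3) && one3 (eval add3 (c :: l)) -> A (f c) = 0.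
  move=> lA ok; apply/eqP; rewrite mset_eq0; apply/negP => cA.
  by apply: (no (c :: l)) ok; rewrite /= cA.
have z1 : A (f (0,0,0)) = 0 by by apply: (zero _ [::]).
have z2 : A (f (0,2,0)) = 0 by apply: (zero _ [:: (0,1,0)]); rewrite //= fb bA.
have z3 : A (f (2,0,0)) = 0 by apply: (zero _ [:: (1,0,0)]); rewrite //= fa aA.
have z4 : A (f (2,2,0)) = 0 by apply: (zero _ [:: (1,0,0); (0,1,0)]); rewrite //= fa fb aA bA.
have vsub9 : map A gs9 \in subvecs [:: 0;2;0;2;2;2;0;2;0].
  by apply: vle_subvecs; rewrite //= z1 z2 z3 z4 !lt3.
have sv : sumn (map A gs9) = size A by rewrite [in RHS]AE size_mset_vec // size_map.
have := long_forms_okT => /allP /(_ _ vsub9); rewrite sv ltA.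
rewrite [nth 0 _ 3]/= fa -in_mset aA [nth 0 _ 1]/= fb -in_mset bA.
rewrite ifT; last by apply/atom9P; rewrite ?size_map // -AE.
by move=> /hasP [l lf /eqP vE]; exists l; rewrite // seq_mset9 -?vE //; exact: forms9_exponents9.
Qed.

Lemma splits_shortP shorts alls v : atom_lists_ok shorts alls -> size v = 9 -> splits_short shorts alls v ->
  exists z, [/\ factorizations (mset_vec gs9 v) z, size z <= 3
    & exists2 W : {mset gT}, W \in z & size W <= 3].
Proof.
move=> /andP [/allP sh9 /allP al9] sv /hasP [w1 w1s];
have := sh9 _ w1s; case: ifP => // le3; case: ifP => // /eqP sw1 at1.
have sg (w : seq nat) : size w = 9 -> size w = size gs9 by move=> ->; rewrite size_map.
have s1 : size (mset_vec gs9 w1) <= 3 by rewrite (size_mset_vec (sg _ sw1)).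
case: ifP => // le1; have w1v : w1 \in subvecs v by apply: vle_subvecs; rewrite // sw1.
rewrite (mset_vec_sub (sg _ sv) w1v); have sr := size_vsub_sub w1v; rewrite sv in sr.
cbv zeta; case: ifP => [at2 _|_].
  exists [mset mset_vec gs9 w1; mset_vec gs9 (vsub v w1)]; split.
  - apply: factorizations_cons; first exact/atom9P.
    by apply: factorizations1; apply/atom9P.
  - by rewrite size_mset_cons enum_msetn.
  - by exists (mset_vec gs9 w1); rewrite // in_mset1D eqxx.
move=> /hasP [w2 w2a]; have /andP [/eqP sw2 at2] := al9 _ w2a.
case: ifP => // le2 at3; have w2r : w2 \in subvecs (vsub v w1).
  by apply: vle_subvecs; rewrite // sw2 sr.
rewrite (mset_vec_sub (sg _ sr) w2r); have sr' := size_vsub_sub w2r; rewrite sr in sr'.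
exists (mset_vec gs9 w1 +` [mset mset_vec gs9 w2; mset_vec gs9 (vsub (vsub v w1) w2)]); split.
- apply: factorizations_cons; first exact/atom9P.
  apply: factorizations_cons; first exact/atom9P.
  by apply: factorizations1; apply/atom9P.
- by rewrite !size_mset_cons enum_msetn.
- by exists (mset_vec gs9 w1); rewrite // in_mset1D eqxx.
Qed.

Lemma long9E t (x y : expo3) : map f (long9 t x y) =
  if t then [:: f x; f x; f y; f y; f x * f y]%g else [:: f x; f y; f x * f y; f x * f y]%g.
Proof. by rewrite /long9; case: t; rewrite /= f9M. Qed.

End Basis.

Lemma long_atom_basis A : atoms A -> 3 < size A ->
  exists a b, [/\ a != 1%g, b \notin <[a]>%g, a \in A & b \in A].
Proof.
move=> atA ltA.
have lsz := long_atom_size abelG (isT : 3 \in [:: 2; 3]) expG atA ltA.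
have l1 := long_atom1 abelG (isT : 3 \in [:: 2; 3]) atA ltA.
have [A0|[a aA]] := mset_0Vmem A; first by rewrite A0 size_mset0 in ltA.
have a1 : a != 1%g by apply/eqP => a1; move: aA; rewrite a1 in_mset l1.
have oa : #|<[a]>%g| = 3 by rewrite -orderE; apply: (@nt_prime_order _ 3).
have [[b [bA ba]]|nb] := pselect (exists b, b \in A /\ b \notin <[a]>%g).
  by exists a, b.
have : size A < #|<[a]>%g|.
  apply: lsz => x xA; apply: contrapT => /negP xa; apply: nb; by exists x.
by rewrite oa; lia.
Qed.

(** The second factor of a product is described by a basis of its own, so in terms
    of the basis for the first factor x and y are arbitrary. *)
Lemma long_atom_forms_any A : atoms A -> 3 < size A -> exists t x y,
  A = seq_mset (if t then [:: x; x; y; y; x * y]%g else [:: x; y; x * y; x * y]%g).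
Proof.
move=> atA ltA; have [a [b [a1 ba aA bA]]] := long_atom_basis atA ltA.
have [l /allpairsP [[[x y] t] /= [_ _ ->]] ->] := long_atom_forms a1 ba atA ltA aA bA.
by exists t, (monomial a b 1%g x), (monomial a b 1%g y); rewrite long9E.
Qed.

Lemma long_atoms_C3xC3 A B : atoms A -> atoms B -> 3 < size A -> 3 < size B ->
  exists z, [/\ factorizations (A `+` B) z, size z <= 3
    & exists2 W : {mset gT}, W \in z & size W <= 3].
Proof.
move=> atA atB ltA ltB; have [a [b [a1 ba aA bA]]] := long_atom_basis atA ltA.
have [k kf kE] := long_atom_forms a1 ba atA ltA aA bA.
have [t [x [y BE]]] := long_atom_forms_any atB ltB.
have /mapP [c cF xE] := mem_gs9 a1 ba x; have /mapP [d dF yE] := mem_gs9 a1 ba y.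
rewrite xE yE -long9E // in BE.
have lF := @long9_exponents9 t _ _ cF dF.
move: short_atoms9 atoms9 atom_lists_okT long_pairs_okT => shorts alls okL.
have tT : t \in [:: true; false] by case: (t).
move=> /allP /(_ c cF) /allP /(_ d dF) /allP /(_ t tT); cbv zeta.
rewrite ifT; last first.
  by apply/(atom9P a1 ba); rewrite ?size_map // -seq_mset9 // -BE.
move=> /allP /(_ k kf) /(splits_shortP a1 ba okL); rewrite size_map => /(_ erefl).
rewrite -seq_mset9 // ?map_cat ?seq_mset_cat -?kE -?BE //.
by move=> e; rewrite mem_cat => /orP [/(forms9_exponents9 kf)|/lF].
Qed.

End C3xC3.

Lemma chain_connected_small (gT : finGroupType) : small_abelem gT ->
  forall S : {mset gT}, chain_connected S 3%N%:Z%:E.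
Proof.
move=> sm.
have [p [p23 [abG eG] c]] : exists p, [/\ p \in [:: 2; 3],
    abelian [set: gT] /\ (forall x : gT, x \in [set: gT] -> x ^+ p = 1)%g
    & #|gT| <= 4 \/ p = 3 /\ #|gT| = 9].
  case: sm => -[ab cG].
  - by exists 3; split=> //; [exact/(abelemP (isT : prime 3))|left; rewrite cG].
  - by exists 2; split=> //; [exact/(abelemP (isT : prime 2))|left; rewrite cG].
  - by exists 3; split=> //; [exact/(abelemP (isT : prime 3))|right].
have abelG (x y : gT) : commute x y by apply: (centsP abG); rewrite inE.
have expG (x : gT) : (x ^+ p = 1)%g by apply: eG; rewrite inE.
apply: chain_connected_abel => // A B atA atB ltA ltB.
case: c => [c4|[p3 c9]]; last by subst p; exact: long_atoms_C3xC3.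
have ltpA : p < size A by move: p23; rewrite !inE => /orP [] /eqP ->; lia.
have := long_atom_size abelG p23 expG atA ltpA (H := [set: gT]%G) (fun x _ => finset.in_setT x).
by rewrite cardsT => /leq_trans /(_ c4); rewrite ltnS leqNgt ltA.
Qed.

Lemma chain_connected_card2 (gT : finGroupType) : #|gT| <= 2 ->
  forall S : {mset gT}, chain_connected S 2%N%:Z%:E.
Proof.
move=> c2.
have expG (x : gT) : (x ^+ 2 = 1)%g.
  have : #[x]%g <= 2.
    by rewrite orderE (leq_trans _ c2) // -cardsT subset_leq_card // finset.subsetT.
  have := order_gt0 x; case E: #[x]%g => [|[|[|m]]] // _ _; last by rewrite -E expg_order.
  by move/eqP: E; rewrite order_eq1 => /eqP ->; rewrite expg1n.
have i2 (x : gT) : (x^-1 = x)%g by exact: invol_inv.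
have abelG (x y : gT) : commute x y by rewrite /commute -[LHS]i2 invMg !i2.
apply: chain_connected_abel => // A B atA atB ltA ltB.
have := long_atom_size abelG (isT : 2 \in [:: 2; 3]) expG atA ltA
  (H := [set: gT]%G) (fun x _ => finset.in_setT x).
by rewrite cardsT => /leq_trans /(_ c2); rewrite ltnS leqNgt (ltnW ltA).
Qed.

(** * The characterization *)

Lemma catenary_degree_le2 (gT : finGroupType) :
  (catenary_degree gT <= 2%:E)%E <-> #|gT| <= 2.
Proof.
split=> [cG|G2]; last first.
  by apply/(catenary_degree_leP gT 2) => S _; exact: chain_connected_card2.
rewrite leqNgt; apply/negP => /has_relation_card [S].
case/has_relation_distance => d dS poS; apply: distances_connected2 dS.
by have /(catenary_degree_leP gT 2) := cG; apply.
Qed.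

Local Close Scope nat_scope.
Local Close Scope ring_scope.
Local Close Scope mset_scope.
Local Close Scope group_scope.

Theorem theorem3p3 (gT : finGroupType) :
  ((catenary_degree gT <= 2%:E)%E <-> (#|gT| <= 2)%N) /\
  [<-> catenary_degree gT = 3%:E;
       delta gT = [set 1%R]%classic;
       daleth gT = 3%:E;
       [\/ [set: gT] \isog [set: 'Z_3],
           [set: gT] \isog [set: 'Z_2 * 'Z_2]
         | [set: gT] \isog [set: 'Z_3 * 'Z_3]]].
Proof.
have c2 := catenary_degree_le2 gT.
split=> //; split; [|split; [|split]].
- rewrite catenary_degree_eq3 => -[c3 nc2].
  have le1 d : delta gT d -> d = 1%R.
    move=> [S poS]; apply: distances_connected3.
    by have /(catenary_degree_leP gT 3) := c3; apply.
  apply/seteqP; split=> d; first exact: le1.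
  move=> ->; have /has_relation_card [S] : (2 < #|gT|)%N.
    by rewrite ltnNge; apply/negP => /c2.
  case/has_relation_distance => e eS poS.
  by have eD := distances_delta poS eS; rewrite -(le1 _ eD).
- move=> delta1; apply/daleth_eq3; split.
    move=> S n L2 Ln n2; apply: (reaches3_of_distance L2 Ln n2) => d dS.
    have : delta gT d by apply: distances_delta dS; exact: lengths_product_one L2.
    by rewrite delta1.
  have [S poS dS] : delta gT 1%R by rewrite delta1.
  apply: has_relation_card; rewrite ltnNge; apply/negP => G2.
  exact: distances_connected2 (@chain_connected_card2 gT G2 S) dS.
- move=> /daleth_eq3 [r3 [S /has_relation_distance [d dS _]]].
  apply/small_abelemP/reaches3_small_abelem; rewrite // ltnNge; apply/negP => G2.
  exact: distances_connected2 (@chain_connected_card2 gT G2 S) dS.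
- move=> /small_abelemP sm; apply/catenary_degree_eq3; split.
    by apply/(catenary_degree_leP gT 3) => S _; exact: chain_connected_small.
  by move=> /c2; case: sm => -[_ ->].
Qed.
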